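(* Let $\Omega\subset\mathbb R^2$ be a domain and let $f\in L^2(\Omega)$, $f\ne 0$, extended by $0$ to $\mathbb R^2$. Let $\lambda:=\|f\|_{L^2}^{-1}$, let $\mathbf u_1\in L^\infty(\mathbb R^2)$ be a minimizer of $$\mathcal V(\mathbf u)=\|\mathbf u\|_{L^\infty}+\lambda\|f-\operatorname{div}\mathbf u\|_{L^2}^2$$ over vector fields $\mathbf u\in L^\infty(\mathbb R^2)$, let $r_1:=f-\operatorname{div}\mathbf u_1$, and let $$\mathbf u_2:=\psi*r_1,\qquad \psi(x)=\frac1{2\pi}\frac{x}{|x|^2},\quad x\in\mathbb R^2 .$$ Then $\mathbf u:=\mathbf u_1+\mathbf u_2$ is uniformly bounded, satisfies $\operatorname{div}\mathbf u=f$, and $$\|\mathbf u\|_{L^\infty}\le(1+C)\|f\|_{L^2},\qquad C:=\frac{\beta_2}{2}\|\psi\|_{L^{2,\infty}}.$$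
   Context: For vector fields, $\|\mathbf u\|_{L^\infty}=\operatorname{ess\,sup}_x|\mathbf u(x)|_2$ with $|\cdot|_2$ the Euclidean norm, and the functional is $+\infty$ when $\operatorname{div}\mathbf u\notin L^2$; the divergence is in the sense of distributions. The total variation is $|g|_{TV}=\sup\{\int g\,\operatorname{div}\mathbf w:\ \mathbf w\in\mathcal D(\mathbb R^2)^2,\ \|\mathbf w\|_{L^\infty}\le1\}$, where $\mathcal D$ denotes smooth compactly supported functions. The Lorentz norm is $\|g\|_{L^{2,1}(\mathbb R^2)}=2\int_0^\infty|\{x:|g(x)|>t\}|^{1/2}\,dt$, and $\beta_2$ is a constant such that $\|g\|_{L^{2,1}(\mathbb R^2)}\le\beta_2|g|_{TV}$ for all $g\in BV(\mathbb R^2)$ (more generally for all $g\in L^2(\mathbb R^2)$ with finite total variation). The norm $\|\psi\|_{L^{2,\infty}}$ is the smallest $K$ with $\int_E|\psi(x)|_2\,dx\le K|E|^{1/2}$ for all measurable $E$ of finite measure. *)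

(* Defs.v *)
(* MathComp-Analysis, over an arbitrary [R : realType]. *)
From mathcomp Require Import all_boot all_order all_algebra.
From mathcomp Require Import all_classical all_reals all_analysis.

Set Implicit Arguments.
Unset Strict Implicit.
Unset Printing Implicit Defensive.

Import Order.TTheory GRing.Theory Num.Theory.
Import numFieldNormedType.Exports.

Local Open Scope classical_set_scope.
Local Open Scope ring_scope.

(* [lebesgue_measure] lives on [measurableTypeR R], a copy of [R]. The type
   below is therefore [R * R] with its Borel sigma-algebra; points, functions
   and vector fields are written on [R * R] and coincide by conversion. *)
Notation plane R := (measurableTypeR R * measurableTypeR R)%type.

Definition leb2 (R : realType) : {measure set (plane R) -> \bar R} :=
  (@lebesgue_measure R \x @lebesgue_measure R)%E.

(* The library norm of [R * R] is the max norm, hence this definition. *)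
Definition enorm {R : realType} (x : R * R) : R :=
  Num.sqrt (x.1 ^+ 2 + x.2 ^+ 2).

Definition supnorm {R : realType} (u : R * R -> R * R) : \bar R :=
  'N[leb2 R]_+oo[EFin \o (enorm \o u)]%E.

Definition Linfty_field {R : realType} (u : R * R -> R * R) : Prop :=
  @measurable_fun _ _ (plane R) (plane R) setT u /\ (supnorm u < +oo)%E.

Definition L2norm {R : realType} (g : R * R -> R) : \bar R :=
  'N[leb2 R]_2%:E[EFin \o g]%E.

(* [partial false] is d/dx_1 and [partial true] is d/dx_2. *)
Definition axis {R : realType} (i : bool) : R * R :=
  if i then (0, 1) else (1, 0).

Definition partial {R : realType} (i : bool) (f : R * R -> R) : R * R -> R :=
  'D_(axis i) f.

Definition smooth {R : realType} (f : R * R -> R) : Prop :=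
  forall s : seq bool, let g := foldr partial f s in
    continuous g /\ forall (i : bool) (x : R * R), derivable g x (axis i).

Definition test_function {R : realType} (phi : R * R -> R) : Prop :=
  smooth phi /\ compact (closure [set x | phi x != 0]).

Definition classical_div {R : realType} (w : R * R -> R * R) : R * R -> R :=
  fun x => partial false (fst \o w) x + partial true (snd \o w) x.

(* div u = g in the sense of distributions on the whole plane *)
Definition is_div {R : realType} (u : R * R -> R * R) (g : R * R -> R) : Prop :=
  forall phi : R * R -> R, test_function phi ->
    \int[leb2 R]_x ((u x).1 * partial false phi x + (u x).2 * partial true phi x)
    = - \int[leb2 R]_x (g x * phi x).

Definition L2_divs {R : realType} (u : R * R -> R * R) : set (R * R -> R) :=
  [set g | g \in Lfun (leb2 R) 2%:E /\ is_div u g].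

(* A representative of div u when div u is in L^2 (it is then unique up to a
   null set); the value [cst 0] in the other case is never relied upon. *)
Definition divL2 {R : realType} (u : R * R -> R * R) : R * R -> R :=
  xget (cst 0) (L2_divs u).

Definition energy {R : realType} (lambda : R) (f : R * R -> R)
    (u : R * R -> R * R) : \bar R :=
  if `[< L2_divs u !=set0 >]
  then (supnorm u + lambda%:E * L2norm (f \- divL2 u)%R ^+ 2)%E
  else +oo%E.

Definition energy_minimizer {R : realType} (lambda : R) (f : R * R -> R)
    (u : R * R -> R * R) : Prop :=
  Linfty_field u /\
  forall v, Linfty_field v -> (energy lambda f u <= energy lambda f v)%E.

Definition totvar {R : realType} (g : R * R -> R) : \bar R :=
  ereal_sup [set (\int[leb2 R]_x (g x * classical_div w x))%:E | w in
    [set w : R * R -> R * R | [/\ test_function (fst \o w),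
      test_function (snd \o w) & (supnorm w <= 1)%E]]].

Definition lorentz21 {R : realType} (g : R * R -> R) : \bar R :=
  (2%:E * \int[lebesgue_measure]_(t in `]0%R, +oo[)
            (leb2 R [set x | (t < `|g x|)%R] `^ 2^-1%R))%E.

(* BV(R^2) is contained in L^2(R^2), so this class of g includes BV. *)
Definition TV_lorentz_bound {R : realType} (beta2 : R) : Prop :=
  forall g : R * R -> R, g \in Lfun (leb2 R) 2%:E -> (totvar g < +oo)%E ->
    (lorentz21 g <= beta2%:E * totvar g)%E.

(* The infimum is the smallest such K, since the condition is closed in K. *)
Definition weakL2norm {R : realType} (w : R * R -> R * R) : \bar R :=
  ereal_inf [set K%:E | K in [set K : R |
    forall E : set (plane R), measurable E -> (leb2 R E < +oo)%E ->
      (\int[leb2 R]_(x in E) (enorm (w x))%:E <= K%:E * leb2 R E `^ 2^-1%R)%E]].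

(* At the origin this evaluates to 0. *)
Definition psi {R : realType} (x : R * R) : R * R :=
  (2 * pi)^-1 *: ((enorm x ^+ 2)^-1 *: x).

Definition convolution {R : realType} (w : R * R -> R * R) (g : R * R -> R)
    (x : R * R) : R * R :=
  (\int[leb2 R]_y ((w (x - y)).1 * g y), \int[leb2 R]_y ((w (x - y)).2 * g y)).

(* Main.v *)
From HB Require Import structures.
Require Import Defs.
From mathcomp Require Import all_boot all_order all_algebra.
From mathcomp Require Import ring lra.
From mathcomp Require Import all_classical all_reals all_analysis.
From mathcomp Require Import measurable_realfun ess_sup_inf.

Set Implicit Arguments.
Unset Strict Implicit.
Unset Printing Implicit Defensive.

Import Order.TTheory GRing.Theory Num.Theory.
Import numFieldNormedType.Exports.

Local Open Scope classical_set_scope.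
Local Open Scope ring_scope.

(** The residual [r1] of a minimizer satisfies [totvar r1 <= ||f|| / 2]: this is
    the first variation of the energy along test fields. The embedding of BV in
    L^{2,1} and the layer cake formula then bound [|psi| * |r1|] uniformly,
    since psi lies in weak L^2, while comparison with the zero field gives
    [||u1|| <= ||f||].

    That [div psi] is the Dirac mass is obtained without polar coordinates: in
    the coordinates (x, x s), whose Jacobian is |x|, [psi . grad phi] becomes
    [sgn x / (2 pi (1 + s^2))] times the derivative of [x |-> phi (x, x s)], and
    the integral over the slopes [s] is [int ds / (1 + s^2) = pi].

    That [beta2] is positive follows from [r1 <> 0], which is obtained by
    comparison with [(1 - e) u1]. *)

(** The value [lambda] = 1/||f|| accounts for both bounds by ||f||: the zero field has energy lambda
    ||f||^2 = ||f||, and the first variation bounds the pairing of [r1] with a test field by 1/(2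
    lambda) = ||f||/2. One uniform bound on the integral of |psi(x - y)| |r1(y)| serves three times:
    the convolution converges at every point, [u2] is bounded, and the exchange of integrals behind
    div [u2] = [r1] is legitimate. The sign of [beta2] matters because the bound on [totvar r1] gets
    multiplied by it. Positivity of the Lorentz norm also allows dividing by it, so that an estimate
    valid for every weak constant K passes to the infimum [weakL2norm psi]. Since [divL2] is some
    representative of the divergence, computing an energy rests on uniqueness of square integrable
    divergences, hence on the fundamental lemma of the calculus of variations; explicit smooth bumps
    converging to indicators of half-open rectangles are built for that purpose. *)

Section plane_measurability.
Context {R : realType}.

(** Measurability refers to the product sigma-algebra, openness to the product topology. They meet
    because an open set is a countable union of boxes with rational centre and radius 1/(n+1); [C]
    discards the boxes that are not contained in [U]. *)
Lemma open_measurable_plane (U : set (R * R)) :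
  open U -> @measurable _ (plane R) U.
Proof.
move=> oU.
pose B (a b : rat) (n : nat) : set (plane R) :=
  ball (ratr a : R) n.+1%:R^-1 `*` ball (ratr b : R) n.+1%:R^-1.
pose C (a b : rat) (n : nat) : set (plane R) :=
  if `[< B a b n `<=` U >] then B a b n else set0.
have -> : U = \bigcup_a \bigcup_b \bigcup_n C a b n.
  apply/seteqP; split => [[x y] Uxy|x [a _ [b _ [n _]]]]; last first.
    by rewrite /C; case: asboolP => // + Bx; exact.
  have [e /= e0 eU] : exists2 e : R, 0 < e & ball ((x, y) : R * R) e `<=` U.
    by have /nbhs_ballP[e /= e0 eU] := open_nbhs_nbhs (conj oU Uxy); exists e.
  (* Half of [e]: a centre within [d] of the point and a box of radius [d] stay within 2d < e. *)
  have [n ne] : exists n, n.+1%:R^-1 < e / 2.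
    have := @near_infty_natSinv_lt R (PosNum (divr_gt0 e0 (@ltr0Sn R 1))).
    by move=> [N _ /(_ N)] /= h; exists N; apply: h.
  have n0 : 0 < n.+1%:R^-1 :> R by rewrite invr_gt0.
  pose d : R := n.+1%:R^-1; rewrite -/d in ne n0.
  have [a] : exists q, ratr q \in `]x - d, x + d[.
    by apply: rat_in_itvoo; lra.
  have [b] : exists q, ratr q \in `]y - d, y + d[.
    by apply: rat_in_itvoo; lra.
  rewrite !in_itv/= => /andP[b1 b2] /andP[a1 a2].
  exists a => //; exists b => //; exists n => //.
  rewrite /C /B -/d; case: asboolP => [_|]; last first.
    case=> -[u v] [/= hu hv]; apply: eU.
    move: hu hv; rewrite /ball/= !ltr_norml => /andP[? ?] /andP[? ?].
    by split; rewrite /ball/= ltr_norml; apply/andP; split; lra.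
  by split; rewrite /ball/= ltr_norml; apply/andP; split; lra.
apply: bigcupT_measurable_rat => a; apply: bigcupT_measurable_rat => b.
apply: bigcupT_measurable => n; rewrite /C; case: asboolP => // _.
by apply: measurableX; exact: measurable_ball.
Qed.

Lemma continuous_measurable_plane (f : plane R -> R) :
  continuous (f : R * R -> R) -> measurable_fun setT f.
Proof.
move=> /continuousP cf; apply: (measurability _ (RGenOpens.measurableE R)).
move=> _ [_ [a [b ->] <-]]; rewrite setTI; apply: open_measurable_plane.
by apply: cf; exact: interval_open.
Qed.

End plane_measurability.

(** * Changes of variables in the plane *)

Section plane_integration.
Context {R : realType}.
Local Notation mu := (@lebesgue_measure R).

(** The pushforward of Lebesgue measure under x |-> a x + b, scaled by |a|, gives half-open
    intervals their length, so it is Lebesgue measure by uniqueness. For a < 0 the preimages are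
    half-open on the other side, with the same length. *)
Lemma ge0_integral_affine (a b : R) (f : measurableTypeR R -> \bar R) :
  a != 0 -> measurable_fun setT f -> (forall x, 0 <= f x)%E ->
  (`|a|%:E * \int[mu]_x f (a * x + b)%R = \int[mu]_x f x)%E.
Proof.
move=> a0 mf f0.
pose phi : measurableTypeR R -> measurableTypeR R := fun x => a * x + b.
have mphi : measurable_fun setT phi.
  by apply: measurable_funD => //; exact: mulrl_measurable.
pose nu0 := mscale (NngNum (normr_ge0 a)) (pushforward mu phi); pose nu := nu0 mphi.
have nuE A : measurable A -> mu A = nu A.
  apply: lebesgue_measure_unique => _ [[c d] _ <-].
  have [cd|dc] := ltP c d; last first.
    have -> : [set` `]c, d]] = set0 :> set R by rewrite set_itv_ge// bnd_simp -leNgt.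
    by rewrite !measure0.
  suff: mu `]c, d]%classic = (`|a|%:E * mu (phi @^-1` `]c, d]%classic))%E by [].
  have [a_gt0|] := ltP 0 a; last rewrite le_eqVlt (negbTE a0)/= => a_lt0.
    have -> : phi @^-1` `]c, d]%classic = `](c - b) / a, (d - b) / a]%classic.
      apply/seteqP; split => x /=; rewrite !in_itv/=;
      by rewrite ltr_pdivrMr// ler_pdivlMr// /phi mulrC ltrBlDr lerBrDr.
    rewrite !lebesgue_measure_itv /= !lte_fin cd ltr_pdivrMr// divfK// ltrD2r cd.
    by rewrite -!EFinD -EFinM gtr0_norm//; congr EFin; field.
  have -> : phi @^-1` `]c, d]%classic = `[(d - b) / a, (c - b) / a[%classic.
    apply/seteqP; split => x /=; rewrite !in_itv/=;
    by rewrite ler_ndivrMr// ltr_ndivlMr// /phi mulrC ltrBlDr lerBrDr andbC.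
  rewrite !lebesgue_measure_itv /= !lte_fin cd ltr_ndivrMr// divfK// ltrD2r cd.
  by rewrite -!EFinD -EFinM ltr0_norm//; congr EFin; field.
have -> : (\int[mu]_x f x = \int[nu]_x f x)%E.
  by apply: eq_measure_integral => A mA _; exact: nuE.
by rewrite ge0_integral_mscale//= ge0_integral_pushforward.
Qed.

Lemma integral_plane_ge0 (f : plane R -> \bar R) :
  measurable_fun setT f -> (forall x, 0 <= f x)%E ->
  (\int[leb2 R]_z f z = \int[mu]_x \int[mu]_y f (x, y))%E.
Proof. by move=> mf f0; rewrite /leb2 (fubini_tonelli1 f mf f0). Qed.

Lemma measurable_affine_plane (p : R * R) (e : R) :
  measurable_fun setT (fun z : plane R => ((p.1 + e * z.1, p.2 + e * z.2) : plane R)).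
Proof.
apply: measurable_fun_pair.
  apply: (@measurable_funD _ (plane R) R) => //.
  by apply: (@measurable_funM _ (plane R) R) => //; exact: measurable_fst.
apply: (@measurable_funD _ (plane R) R) => //.
by apply: (@measurable_funM _ (plane R) R) => //; exact: measurable_snd.
Qed.

(** The case e = 1 is a translation and e = -1 a point reflection z |-> p - z, the two substitutions
    that a convolution calls for. *)
Lemma ge0_integral_plane_isometry (p : R * R) (e : R) (f : plane R -> \bar R) :
  `|e| = 1 -> measurable_fun setT f -> (forall x, 0 <= f x)%E ->
  (\int[leb2 R]_z f (p.1 + e * z.1, p.2 + e * z.2)%R = \int[leb2 R]_z f z)%E.
Proof.
move=> e1 mf f0.
have e0 : e != 0 by rewrite -normr_eq0 e1 oner_neq0.
rewrite !integral_plane_ge0//; last first.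
  by apply: (measurableT_comp mf); exact: measurable_affine_plane.
pose F (x : measurableTypeR R) := (\int[mu]_y f (x, y))%E.
have mF : measurable_fun setT F by exact: (measurable_fun_fubini_tonelli_F f).
have aff (g : measurableTypeR R -> \bar R) q : measurable_fun setT g ->
    (forall x, 0 <= g x)%E -> (\int[mu]_x g (q + e * x)%R = \int[mu]_x g x)%E.
  move=> mg g0; rewrite -[RHS](ge0_integral_affine q e0)// e1 mul1e.
  by apply: eq_integral => x _; rewrite addrC.
transitivity (\int[mu]_x F (p.1 + e * x)%R)%E.
  apply: eq_integral => x _ /=.
  apply: (aff (fun y => f (p.1 + e * x, y)%R)) => //.
  by apply: measurableT_comp => //; exact: pair1_measurable.
by rewrite aff// => x; exact: integral_ge0.
Qed.

Lemma integral_plane_isometry (p : R * R) (e : R) (f : plane R -> \bar R) :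
  `|e| = 1 -> measurable_fun setT f ->
  (\int[leb2 R]_z f (p.1 + e * z.1, p.2 + e * z.2)%R = \int[leb2 R]_z f z)%E.
Proof.
move=> e1 mf; rewrite integralE [RHS]integralE.
congr (_ - _)%E.
  rewrite -(@ge0_integral_plane_isometry p e _ e1 (measurable_funepos mf))//.
  by apply: eq_integral => z _; rewrite !funeposE.
rewrite -(@ge0_integral_plane_isometry p e _ e1 (measurable_funeneg mf))//.
by apply: eq_integral => z _; rewrite !funenegE.
Qed.

Lemma measurable_plane_slope (f : plane R -> \bar R) : measurable_fun setT f ->
  measurable_fun setT (fun z : plane R => `|z.1|%R%:E * f (z.1, z.1 * z.2)%R)%E.
Proof.
move=> mf; apply: emeasurable_funM.
  apply/measurable_EFinP.
  by apply: (@measurableT_comp _ _ _ _ R) => //; exact: measurable_fst.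
apply: (measurableT_comp mf); apply: measurable_fun_pair; first exact: measurable_fst.
by apply: (@measurable_funM _ (plane R) R); [exact: measurable_fst|exact: measurable_snd].
Qed.

(* The change of variables (x, s) |-> (x, x s), with Jacobian |x|, plays the
   role of polar coordinates. *)
Lemma integral_plane_slope (f : plane R -> \bar R) :
  measurable_fun setT f ->
  (\int[leb2 R]_z (`|z.1|%R%:E * f (z.1, z.1 * z.2)%R) = \int[leb2 R]_z f z)%E.
Proof.
have ge0 (g : plane R -> \bar R) : measurable_fun setT g -> (forall x, 0 <= g x)%E ->
    (\int[leb2 R]_z (`|z.1|%R%:E * g (z.1, z.1 * z.2)%R) = \int[leb2 R]_z g z)%E.
  move=> mg g0.
  rewrite !integral_plane_ge0 //; [|exact: measurable_plane_slope|by move=> x; rewrite mule_ge0].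
  have mG : measurable_fun setT (fun x : measurableTypeR R => \int[mu]_y g (x, y))%E.
    exact: (measurable_fun_fubini_tonelli_F g).
  apply: ae_eq_integral => //.
    apply: (measurable_fun_fubini_tonelli_F
      (fun z : plane R => `|z.1|%R%:E * g (z.1, z.1 * z.2)%R)%E) => //.
      exact: measurable_plane_slope.
    by move=> x; rewrite mule_ge0.
  (* For x = 0 the slope substitution degenerates and the two inner integrals may differ, but a
     single abscissa is a null set. *)
  exists [set 0]; split => //; first exact: lebesgue_measure_set1.
  move=> x /= /not_implyP[_ h]; apply: contrapT => /eqP x0; apply: h.
  have mgx : measurable_fun setT (fun y : measurableTypeR R => g (x, y)).
    by apply: measurableT_comp => //; exact: pair1_measurable.
  rewrite ge0_integralZl//; last first.
    by apply: (measurableT_comp mgx); exact: mulrl_measurable.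
  rewrite -[RHS](ge0_integral_affine 0 x0)//; congr (_ * _)%E.
  by apply: eq_integral => y _; rewrite addr0.
move=> mf; rewrite integralE [RHS]integralE.
rewrite -(ge0 _ (measurable_funepos mf) (funepos_ge0 _)).
rewrite -(ge0 _ (measurable_funeneg mf) (funeneg_ge0 _)).
congr (_ - _)%E; apply: eq_integral => z _.
  by rewrite !funeposE maxe_pMr ?mule0// lee_fin.
by rewrite !funenegE maxe_pMr ?mule0// ?muleN// lee_fin.
Qed.

End plane_integration.

(** * Tonelli and Fubini over the plane *)

Section sigma_finite_plane.
Context {R : realType}.
Local Notation mu := (@lebesgue_measure R).

(* A transparent copy of [leb2 R] carrying the sigma-finite structure: the
   product instance of the library is shadowed by the one for subprobabilities. *)
Definition leb2_sf : set (plane R) -> \bar R := leb2 R.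

Lemma sigma_finite_leb2 : sigma_finite setT leb2_sf.
Proof.
pose I n : set (measurableTypeR R) := `[- n%:R, n%:R]%classic.
have mI n : measurable (I n) by exact: measurable_itv.
exists (fun n => I n `*` I n).
  apply/seteqP; split => // -[x y] _.
  have [n xn] : exists n : nat, Num.max `|x| `|y| <= n%:R.
    exists (Num.bound (Num.max `|x| `|y|)); apply/ltW/archi_boundP.
    by rewrite le_max normr_ge0.
  exists n => //; move: xn; rewrite ge_max !ler_norml => /andP[xn yn].
  by split; rewrite /I /= in_itv.
move=> n; split; first exact: measurableX.
have [c cE] : exists c : R, mu (I n) = c%:E.
  have /= := @lebesgue_measure_itv R `[- n%:R, n%:R]; rewrite -EFinB.
  by case: ifPn => _ E; [exists (n%:R - - n%:R)|exists 0]; exact: E.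
have -> : leb2_sf (I n `*` I n) = (mu (I n) * mu (I n))%E by exact: product_measure1E.
by rewrite cE -EFinM ltry.
Qed.

HB.instance Definition _ := Measure.copy leb2_sf (leb2 R).
HB.instance Definition _ := Measure_isSigmaFinite.Build _ _ _ leb2_sf sigma_finite_leb2.

Lemma tonelli_level (G : plane R * measurableTypeR R -> \bar R) :
  measurable_fun setT G -> (forall z, 0 <= G z)%E ->
  (\int[leb2 R]_y \int[mu]_t G (y, t) = \int[mu]_t \int[leb2 R]_y G (y, t))%E.
Proof. by move=> mG G0; exact: (@fubini_tonelli _ _ _ _ R leb2_sf mu G mG G0). Qed.

Lemma measurable_level (G : plane R * measurableTypeR R -> \bar R) :
  measurable_fun setT G -> (forall z, 0 <= G z)%E ->
  measurable_fun setT (fun t => \int[leb2 R]_y G (y, t))%E.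
Proof. by move=> mG G0; exact: (@measurable_fun_fubini_tonelli_G _ _ _ _ R leb2_sf G mG G0). Qed.

Lemma measurable_integral_plane (G : plane R * plane R -> \bar R) :
  measurable_fun setT G -> (forall z, 0 <= G z)%E ->
  measurable_fun setT (fun x => \int[leb2 R]_y G (x, y))%E.
Proof. by move=> mG G0; exact: (@measurable_fun_fubini_tonelli_F _ _ _ _ R leb2_sf G mG G0). Qed.

Lemma fubini_plane (G : plane R * plane R -> \bar R) :
  measurable_fun setT G -> (\int[leb2 R]_x \int[leb2 R]_y `|G (x, y)| < +oo)%E ->
  (\int[leb2 R]_x \int[leb2 R]_y G (x, y) = \int[leb2 R]_y \int[leb2 R]_x G (x, y))%E.
Proof.
move=> mG /(@integrable12ltyP _ _ _ _ R leb2_sf leb2_sf G mG).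
exact: (@Fubini _ _ _ _ R leb2_sf leb2_sf G).
Qed.

End sigma_finite_plane.

(** * One-variable calculus *)

Section line_calculus.
Context {R : realType}.
Local Notation mu := (@lebesgue_measure R).
Implicit Types F dF : R -> R.

Lemma is_derive_continuous F dF :
  (forall x, is_derive x (1 : R) F (dF x)) -> continuous F.
Proof.
move=> dFE x; apply: differentiable_continuous; apply/derivable1_diffP.
by have [] := dFE x.
Qed.

Lemma MVT_increment F dF (a h : R) :
  (forall x, is_derive x (1 : R) F (dF x)) ->
  exists2 c, `|c - a| <= `|h| & F (a + h) - F a = dF c * h.
Proof.
move=> dFE; have cF := is_derive_continuous dFE.
have [h0|h0] := leP 0 h.
  have [| |c] := @MVT_segment R F dF a (a + h); rewrite ?lerDl//.
    exact: continuous_subspaceT.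
  rewrite in_itv/= => /andP[ac ch] ->; exists c; last by congr (_ * _); ring.
  by rewrite ger0_norm ?subr_ge0// ger0_norm// lerBlDl.
have [| |c] := @MVT_segment R F dF (a + h) a; rewrite ?gerDl ?ltW//.
  exact: continuous_subspaceT.
rewrite in_itv/= => /andP[ac ch] E; exists c.
  by rewrite ler0_norm ?subr_le0// ltr0_norm//; lra.
by rewrite -[LHS]opprB E; ring.
Qed.

Lemma integral_itv_deriv F dF (a b : R) : a < b ->
  (forall x, is_derive x (1 : R) F (dF x)) -> continuous dF ->
  (\int[mu]_(x in `[a, b]) (dF x)%:E = (F b - F a)%:E)%E.
Proof.
move=> ab dFE cdF; have cF := is_derive_continuous dFE.
rewrite EFinB; apply: continuous_FTC2 => //.
- exact: continuous_subspaceT.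
- split; [by move=> x _; have [] := dFE x| |].
  + by apply: cvg_at_right_filter; exact: cF.
  + by apply: cvg_at_left_filter; exact: cF.
- by move=> x _; rewrite derive1E; have [] := dFE x.
Qed.

Lemma deriv_eq0_outside F dF (N : R) :
  (forall x, is_derive x (1 : R) F (dF x)) -> (forall x, N <= `|x| -> F x = 0) ->
  forall x, N < `|x| -> dF x = 0.
Proof.
move=> dFE F0 x Nx; have [_ <-] := dFE x.
rewrite (@near_eq_derive R R R F (cst 0)) ?oner_eq0 ?derive_cst//.
have : \forall z \near x, N < `|z|.
  by have /cvgr_gt := @norm_continuous R R x; exact.
by apply: filterS => z /ltW; exact: F0.
Qed.

Section half_lines.
Variables (F dF : R -> R) (N : R).
Hypotheses (N0 : 0 < N) (dFE : forall x, is_derive x (1 : R) F (dF x)).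
Hypotheses (cdF : continuous dF) (F0 : forall x, N <= `|x| -> F x = 0).

Let dF0 x : N < `|x| -> dF x = 0.
Proof. exact: deriv_eq0_outside. Qed.

Lemma integral_deriv_itvy :
  (\int[mu]_(x in `[0%R, +oo[) (dF x)%:E = (- F 0)%:E)%E.
Proof.
transitivity (\int[mu]_(x in `[0%R, N]) (dF x)%:E)%E; last first.
  by rewrite (integral_itv_deriv N0 dFE)// F0 ?sub0r// ger0_norm// ltW.
rewrite integral_mkcond [RHS]integral_mkcond; apply: eq_integral => x _.
rewrite /patch !mem_setE !in_itv/= andbT.
case: (leP 0 x) => x0 //=.
by case: ifPn => //; rewrite -ltNge => xN; rewrite dF0// ger0_norm.
Qed.

Lemma integral_deriv_itvNy :
  (\int[mu]_(x in `]-oo, 0%R]) (dF x)%:E = (F 0)%:E)%E.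
Proof.
transitivity (\int[mu]_(x in `[(- N)%R, 0%R]) (dF x)%:E)%E; last first.
  rewrite (integral_itv_deriv _ dFE)// ?oppr_lt0// [F (- N)]F0 ?subr0//.
  by rewrite normrN ger0_norm// ltW.
rewrite integral_mkcond [RHS]integral_mkcond; apply: eq_integral => x _.
rewrite /patch !mem_setE !in_itv/=.
case: (leP x 0) => x0; rewrite ?andbT ?andbF//=.
by case: ifPn => //; rewrite -ltNge => xN; rewrite dF0// ler0_norm// ltrNr.
Qed.

Let mdF : measurable_fun setT (dF : measurableTypeR R -> R).
Proof. exact: continuous_measurable_fun. Qed.

Let idF : mu.-integrable setT (EFin \o dF).
Proof.
apply: (@eq_integrable _ _ _ mu setT measurableT ((EFin \o dF) \_ `[(- N)%R, N])).
  move=> x _; rewrite /patch mem_setE in_itv/= -ler_norml.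
  by case: ifPn => //; rewrite -ltNge => /dF0 /= ->.
have mI : measurable ([set` `[- N, N]] : set (measurableTypeR R)) by exact: measurable_itv.
apply: (iffLR (integrable_mkcond _ mI)).
apply: continuous_compact_integrable; first exact: segment_compact.
exact: continuous_subspaceT.
Qed.

(** Weight 1 gives the vanishing of the integral of a derivative, weight sgn gives twice the value
    at the origin. Each half-line is handled with a constant weight, and the point 0 between them is
    null. *)
Let integral_split (s : R -> R) :
  measurable_fun setT (s : measurableTypeR R -> R) ->
  (forall x, 0 < x -> s x = s 1) -> (forall x, x < 0 -> s x = s (-1)) ->
  (\int[mu]_x (s x * dF x)%:E = (s (-1) * F 0 - s 1 * F 0)%:E)%E.
Proof.
move=> ms sp sn.
have mG : measurable_fun setT (fun x : measurableTypeR R => (s x * dF x)%:E).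
  by apply/measurable_EFinP; exact: measurable_funM.
have dFS (D : set (measurableTypeR R)) : measurable D -> mu.-integrable D (EFin \o dF).
  by move=> mD; exact: integrableS idF.
have mn : measurable (`]-oo, 0%R[%classic : set (measurableTypeR R)) by exact: measurable_itv.
have mp : measurable (`[0%R, +oo[%classic : set (measurableTypeR R)) by exact: measurable_itv.
have mp' : measurable (`]0%R, +oo[%classic : set (measurableTypeR R)) by exact: measurable_itv.
rewrite -(setUv `]-oo, 0[%classic) setCitvl (integral_setU _ mn mp); last 2 first.
- exact: measurable_funTS.
- apply/disj_setPS => x [/=]; rewrite !in_itv/= andbT => x0.
  by rewrite leNgt x0.
rewrite EFinB; congr (_ + _)%E.
  transitivity (\int[mu]_(x in `]-oo, 0%R[) ((s (-1))%:E * (dF x)%:E))%E.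
    by apply: eq_integral => x; rewrite inE/= in_itv/= => /sn ->.
  rewrite (integralZl mn (dFS _ mn)).
  rewrite integral_itv_bndo_bndc; last by apply/measurable_EFinP; exact: measurable_funTS.
  by rewrite integral_deriv_itvNy -EFinM.
rewrite -integral_itv_obnd_cbnd; last exact: measurable_funTS.
transitivity (\int[mu]_(x in `]0%R, +oo[) ((s 1)%:E * (dF x)%:E))%E.
  by apply: eq_integral => x; rewrite inE/= in_itv/= andbT => /sp ->.
rewrite (integralZl mp' (dFS _ mp')).
rewrite integral_itv_obnd_cbnd; last by apply/measurable_EFinP; exact: measurable_funTS.
by rewrite integral_deriv_itvy -EFinM mulrN.
Qed.

Lemma integral_deriv : (\int[mu]_x (dF x)%:E = 0)%E.
Proof.
transitivity (\int[mu]_x (cst 1 x * dF x)%:E)%E.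
  by apply: eq_integral => x _; rewrite mul1r.
by rewrite integral_split//= subrr.
Qed.

(** This is the distributional identity sgn' = 2 delta_0: each half-line contributes [- F 0]. *)
Lemma integral_sg_deriv :
  (\int[mu]_x (Num.sg x * dF x)%:E = (- (2 * F 0))%:E)%E.
Proof.
rewrite (integral_split (s := fun x => Num.sg x)).
- by rewrite sgrN !sgr1; congr EFin; ring.
- rewrite (_ : (fun x => _) = fun x : measurableTypeR R => if 0 < x then 1 else if x < 0 then -1 else 0).
    apply: measurable_fun_ifT => //; first exact: measurable_fun_ltr.
    by apply: measurable_fun_ifT => //; exact: measurable_fun_ltr.
  apply/funext => x; case: ltgtP => [x0|x0|<-]; rewrite ?sgr0//.
    exact: gtr0_sg.
  exact: ltr0_sg.
- by move=> x x0; rewrite sgr1 gtr0_sg.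
- by move=> x x0; rewrite sgrN sgr1 ltr0_sg.
Qed.

End half_lines.
End line_calculus.

(** * Compactly supported C^1 functions on the plane *)

Section plane_calculus.
Context {R : realType}.
Local Notation mu := (@lebesgue_measure R).
Implicit Types f g : R * R -> R.

Lemma continuous_pair (u v : R -> R) :
  continuous u -> continuous v -> continuous (fun t => (u t, v t)).
Proof. by move=> cu cv t; exact: (cvg_pair (cu t) (cv t)). Qed.

Definition box_supported (N : R) g :=
  forall x, (N <= `|x.1|) || (N <= `|x.2|) -> g x = 0.

(** Only derivatives along the axes are recorded, in accordance with [smooth], and the support is
    confined to a square, which suits slicing by lines parallel to the axes. The class contains the
    test functions and is stable under products and translations. *)
Definition C1c g := [/\ continuous g, forall i x, derivable g x (axis i),
  forall i, continuous (partial i g) & exists2 N, 0 < N & box_supported N g].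

Lemma leb2_setX (A B : set (measurableTypeR R)) : measurable A -> measurable B ->
  (leb2 R (A `*` B) = mu A * mu B)%E.
Proof. exact: product_measure1E. Qed.

Lemma box_supported_bounded g N : continuous g -> box_supported N g ->
  exists2 M, 0 <= M & forall x, `|g x| <= M.
Proof.
move=> cg gN.
have [M [_ gM]] : bounded_set (g @` (`[- N, N] `*` `[- N, N])).
  apply: compact_bounded; apply: continuous_compact.
    exact: continuous_subspaceT.
  by apply: compact_setX; exact: segment_compact.
exists (`|M| + 1) => [|x]; first by rewrite addr_ge0.
have [xN|/negP] := boolP ((N <= `|x.1|) || (N <= `|x.2|)).
  by rewrite gN// normr0 addr_ge0.
move=> /negP; rewrite negb_or -!ltNge => /andP[x1 x2].
apply: (gM (`|M| + 1)); first by rewrite (le_lt_trans (ler_norm M)) ?ltrDl.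
by exists x => //; split; rewrite /= in_itv/= -ler_norml ltW.
Qed.

Lemma box_supported_integrable (g : plane R -> R) N M :
  measurable_fun setT g -> (forall x, `|g x| <= M) -> box_supported N g ->
  (leb2 R).-integrable setT (EFin \o g).
Proof.
move=> mg gM gN.
pose I : set (measurableTypeR R) := `[- N, N]%classic.
have mI : measurable I by exact: measurable_itv.
have mII : measurable (I `*` I) by exact: measurableX.
apply: (@eq_integrable _ _ _ (leb2 R) setT measurableT ((EFin \o g) \_ (I `*` I))).
  move=> x _; rewrite /patch; case: ifPn => //; rewrite notin_setE => xI.
  rewrite /= gN//; apply/negbNE; rewrite negb_or -!ltNge; apply/negP => /andP[x1 x2].
  by apply: xI; split; rewrite /I /= in_itv/= -ler_norml ltW.
apply: (iffLR (integrable_mkcond _ mII)).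
apply: measurable_bounded_integrable => //.
- rewrite /= leb2_setX// lebesgue_measure_itv/=.
  by case: ifPn; rewrite ?mule0 ?ltry// -EFinB -EFinM ltry.
- exact: measurable_funTS.
- by exists M; split; [exact: num_real|move=> y My x _; exact: le_trans (ltW My)].
Qed.

Lemma is_derive_slice1 g t y : derivable g (t, y) (axis false) ->
  is_derive t (1 : R) (fun t => g (t, y)) (partial false g (t, y)).
Proof.
move=> dg; have E : (fun h : R => h^-1 *: ((g \o shift (t, y)) (h *: axis false) - g (t, y)))
   = (fun h : R => h^-1 *: (((fun t => g (t, y)) \o shift t) (h *: 1) - g (t, y))).
  apply/funext => h /=; congr (_ *: (g _ - _)).
  rewrite /axis /=; congr pair; first exact: etrans (congr1 (+%R^~ y) (scaler0 _ h)) (add0r y).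
split; first by rewrite /derivable /= -E.
by rewrite /derive -E.
Qed.

Lemma is_derive_slice2 g x t : derivable g (x, t) (axis true) ->
  is_derive t (1 : R) (fun t => g (x, t)) (partial true g (x, t)).
Proof.
move=> dg; have E : (fun h : R => h^-1 *: ((g \o shift (x, t)) (h *: axis true) - g (x, t)))
   = (fun h : R => h^-1 *: (((fun t => g (x, t)) \o shift t) (h *: 1) - g (x, t))).
  apply/funext => h /=; congr (_ *: (g _ - _)).
  rewrite /axis /=; congr pair; exact: etrans (congr1 (+%R^~ x) (scaler0 _ h)) (add0r x).
split; first by rewrite /derivable /= -E.
by rewrite /derive -E.
Qed.

(** The margin 1 gives the point a neighbourhood on which [g] vanishes; where a coordinate has
    absolute value exactly [N] there may be none. *)
Lemma box_supported_partial g N i :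
  box_supported N g -> box_supported (N + 1) (partial i g).
Proof.
move=> gN x xN; rewrite /partial (@near_eq_derive _ _ _ g (cst 0)) ?derive_cst//.
have {xN} : (N < `|x.1|) || (N < `|x.2|).
  by case/orP: xN => xN; rewrite (lt_le_trans _ xN) ?ltrDl ?orbT.
case/orP => xN.
  have /cvgr_gt/(_ _ xN) : (fun z : R * R => `|z.1|) @ x --> `|x.1|.
    by apply: cvg_norm; exact: cvg_fst.
  by apply: filterS => z zN; apply: gN; rewrite ltW.
have /cvgr_gt/(_ _ xN) : (fun z : R * R => `|z.2|) @ x --> `|x.2|.
  by apply: cvg_norm; exact: cvg_snd.
by apply: filterS => z zN; apply: gN; rewrite (ltW zN) orbT.
Qed.

Lemma C1c_partial_bound g : C1c g ->
  exists N M, [/\ 0 < N, box_supported N g, forall i, box_supported N (partial i g),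
   forall x, `|g x| <= M & forall i x, `|partial i g x| <= M].
Proof.
move=> [cg _ cdg [N N0 gN]].
have [M M0 gM] := box_supported_bounded cg gN.
have [M1 M10 gM1] := box_supported_bounded (cdg false) (box_supported_partial false gN).
have [M2 M20 gM2] := box_supported_bounded (cdg true) (box_supported_partial true gN).
exists (N + 1), (M + (M1 + M2)); split.
- by rewrite addr_gt0.
- move=> x /orP[] xN; apply: gN; rewrite (le_trans _ xN) ?orbT// lerDl//.
- by move=> i; exact: box_supported_partial.
- by move=> x; rewrite (le_trans (gM x))// lerDl addr_ge0.
- case=> x; first by rewrite (le_trans (gM2 x))// addrA lerDr addr_ge0.
  by rewrite (le_trans (gM1 x))// addrCA lerDl addr_ge0.
Qed.

Lemma C1c_measurable g : C1c g -> measurable_fun setT (g : plane R -> R).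
Proof. by case=> cg _ _ _; exact: continuous_measurable_plane. Qed.

Lemma C1c_partial_measurable g i :
  C1c g -> measurable_fun setT (partial i g : plane R -> R).
Proof. by case=> _ _ cg _; exact: continuous_measurable_plane. Qed.

Lemma C1c_integrable g : C1c g -> (leb2 R).-integrable setT (EFin \o g).
Proof.
move=> cg; have [N [M [_ gN _ gM _]]] := C1c_partial_bound cg.
by apply: (box_supported_integrable _ gM gN); exact: C1c_measurable.
Qed.

Lemma C1c_partial_integrable g i :
  C1c g -> (leb2 R).-integrable setT (EFin \o partial i g).
Proof.
move=> cg; have [N [M [_ _ gN _ gM]]] := C1c_partial_bound cg.
by apply: (box_supported_integrable _ (gM i) (gN i)); exact: C1c_partial_measurable.
Qed.

Lemma C1c_partialM f g i x : C1c f -> C1c g ->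
  partial i (f \* g) x = f x * partial i g x + g x * partial i f x.
Proof.
move=> [_ df _ _] [_ dg _ _]; rewrite /partial.
by have [_ /= ->] := is_deriveM (derivableP (df i x)) (derivableP (dg i x)).
Qed.

Lemma C1cM f g : C1c f -> C1c g -> C1c (f \* g).
Proof.
move=> Cf Cg; have [cf df cdf [N N0 fN]] := Cf; have [cg dg cdg _] := Cg.
split.
- by move=> x; exact: (cvgM (cf x) (cg x)).
- by move=> i x; apply: derivableM; [exact: df|exact: dg].
- move=> i; have -> : partial i (f \* g) = (f \* partial i g) \+ (g \* partial i f).
    by apply/funext => x; exact: C1c_partialM.
  by move=> x; exact: (cvgD (cvgM (cf x) (cdg i x)) (cvgM (cg x) (cdf i x))).
- by exists N => // x xN /=; rewrite fN// mul0r.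
Qed.

Lemma test_function_C1c f : test_function f -> C1c f.
Proof.
move=> [sf cf]; split.
- by have [] := sf [::].
- by move=> i x; have [_] := sf [::]; exact.
- by move=> i; have [] := sf [:: i].
have [M [_ fM]] := compact_bounded cf.
(* The support is bounded by every number above [M], here [|M| + 1]; one more unit makes the
   comparison strict. *)
exists (`|M| + 2) => [|x xN]; first by rewrite ltr_wpDl.
apply/eqP; apply: contraPT xN => fx.
have M1 : M < `|M| + 1 by rewrite (le_lt_trans (ler_norm M))// ltrDl.
have : `|x| <= `|M| + 1 by apply: (fM _ M1); exact: subset_closure.
rewrite prod_normE ge_max => /andP[x1 x2].
by apply/negP; rewrite negb_or -!ltNge (le_lt_trans x1) ?(le_lt_trans x2) ?ltrD2l// ltr1n.
Qed.

(** Integrating first along the direction of differentiation leaves the derivative of a compactly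
    supported function on a line, whose integral is zero; hence the two orders of Fubini. *)
Lemma integral_partial g i : C1c g -> (\int[leb2 R]_x (partial i g x)%:E = 0)%E.
Proof.
move=> cg; have ig := C1c_partial_integrable i cg.
have [N [M [N0 gN dgN gM dgM]]] := C1c_partial_bound cg.
case: cg => cg dg cdg _; case: i ig => ig.
  rewrite -(integral12_prod_meas1 ig) /fubini_F /=; apply: integral0_eq => x _.
  apply: (@integral_deriv R (fun y => g (x, y)) _ N) => //.
  - by move=> y; exact: (is_derive_slice2 (dg true (x, y))).
  - move=> y; apply: (@continuous_comp _ _ _ (fun y => (x, y)) (partial true g)); last exact: cdg.
    by apply: continuous_pair => // z; [exact: cvg_cst|exact: cvg_id].
  - by move=> y yN; apply: gN; rewrite /= yN orbT.
rewrite -(integral21_prod_meas1 ig) /fubini_G /=; apply: integral0_eq => y _.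
apply: (@integral_deriv R (fun x => g (x, y)) _ N) => //.
- by move=> x; exact: (is_derive_slice1 (dg false (x, y))).
- move=> x; apply: (@continuous_comp _ _ _ (fun x => (x, y)) (partial false g)); last exact: cdg.
  by apply: continuous_pair => // z; [exact: cvg_id|exact: cvg_cst].
- by move=> x xN; apply: gN; rewrite /= xN.
Qed.

Lemma C1c_mul_partial_integrable f g i : C1c f -> C1c g ->
  (leb2 R).-integrable setT (fun x => (f x * partial i g x)%:E).
Proof.
move=> Cf Cg.
have [N [M [_ fN _ fM _]]] := C1c_partial_bound Cf.
have [_ [M' [_ _ _ _ gM]]] := C1c_partial_bound Cg.
apply: (@box_supported_integrable (fun x => f x * partial i g x) N (M * M')).
- by apply: measurable_funM; [exact: C1c_measurable|exact: C1c_partial_measurable].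
- by move=> x; rewrite normrM ler_pM.
- by move=> x xN; rewrite fN// mul0r.
Qed.

Lemma integral_by_parts f g i : C1c f -> C1c g ->
  \int[leb2 R]_x (f x * partial i g x) = - \int[leb2 R]_x (partial i f x * g x).
Proof.
move=> Cf Cg; apply/eqP; rewrite -addr_eq0; apply/eqP.
under [X in _ + X]eq_Rintegral do rewrite mulrC.
rewrite -RintegralD//; [|exact: C1c_mul_partial_integrable..].
rewrite -[RHS](_ : fine 0%E = _)// -(integral_partial i (C1cM Cf Cg)) /Rintegral.
by congr fine; apply: eq_integral => x _; rewrite C1c_partialM.
Qed.

(** This makes a test field an admissible direction of variation for the energy. *)
Lemma is_div_classical (w : R * R -> R * R) :
  C1c (fst \o w) -> C1c (snd \o w) -> is_div w (classical_div w).
Proof.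
move=> C1 C2 phi /test_function_C1c Cp.
rewrite (RintegralD _ (C1c_mul_partial_integrable false C1 Cp)
  (C1c_mul_partial_integrable true C2 Cp))//.
rewrite (integral_by_parts _ C1 Cp) (integral_by_parts _ C2 Cp) -opprD; congr (- _).
have com h i : C1c h -> (leb2 R).-integrable setT (fun x => (partial i h x * phi x)%:E).
  move=> Ch; apply: eq_integrable (C1c_mul_partial_integrable i Cp Ch) => //.
  by move=> x _; rewrite mulrC.
rewrite -RintegralD//; [|exact: com..].
by apply: eq_Rintegral => x _; rewrite -mulrDl.
Qed.

(** A chain rule obtained from continuity of the partials, without total differentiability: the
    increment is split into a horizontal and a vertical step, with the mean value theorem on each.
    The vertical error gets multiplied by [s], hence the tolerance e/(1 + |s|). *)
Lemma is_derive_slope g (s t : R) : C1c g ->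
  is_derive t (1 : R) (fun t => g (t, t * s))
    (partial false g (t, t * s) + s * partial true g (t, t * s)).
Proof.
move=> [_ dg cdg _].
set G := fun t : R => _; set L := _ + _.
suff cG : (fun h : R => h^-1 *: ((G \o shift t) (h *: 1) - G t)) @ 0^' --> L.
  by split; [apply: cvgP cG|exact: cvg_lim cG].
have s1 : 0 < 1 + `|s| by rewrite ltr_pwDl.
apply/cvgrPdist_le => e e0.
pose p : R * R := (t, t * s).
have e1 : 0 < e / (1 + `|s|) by rewrite divr_gt0.
have [d1 /= d10 b1] : exists2 d, 0 < d & forall z, ball p d z ->
    `|partial false g p - partial false g z| <= e / (1 + `|s|).
  by have /cvgrPdist_le/(_ _ e1)/nbhs_ballP[d d0 bd] := cdg false p; exists d.
have [d2 /= d20 b2] : exists2 d, 0 < d & forall z, ball p d z ->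
    `|partial true g p - partial true g z| <= e / (1 + `|s|).
  by have /cvgrPdist_le/(_ _ e1)/nbhs_ballP[d d0 bd] := cdg true p; exists d.
pose d := Num.min d1 d2; have d0 : 0 < d by rewrite lt_min d10.
have D1 u v : `|u - t| < d -> `|v - t * s| < d ->
    `|partial false g p - partial false g (u, v)| <= e / (1 + `|s|).
  move=> ut vt; apply: b1; split; rewrite /ball/= distrC.
    by rewrite (lt_le_trans ut)// ge_min lexx.
  by rewrite (lt_le_trans vt)// ge_min lexx.
have D2 u v : `|u - t| < d -> `|v - t * s| < d ->
    `|partial true g p - partial true g (u, v)| <= e / (1 + `|s|).
  move=> ut vt; apply: b2; split; rewrite /ball/= distrC.
    by rewrite (lt_le_trans ut)// ge_min lexx orbT.
  by rewrite (lt_le_trans vt)// ge_min lexx orbT.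
near=> h.
have h0 : h != 0 by near: h; exact: nbhs_dnbhs_neq.
(* One smallness condition controls both the horizontal step [h] and the vertical step [h * s]. *)
have hd : `|h| < d / (1 + `|s|).
  near: h; apply: dnbhs0_lt; exact: divr_gt0.
have hd1 : `|h| < d.
  by rewrite (lt_le_trans hd)// ler_pdivrMr// ler_peMr// ?lerDl// ltW.
have hd2 : `|h * s| < d.
  move: hd; rewrite ltr_pdivlMr// normrM mulrDr mulr1.
  by apply: le_lt_trans; rewrite lerDr.
have [c1 c1t E1] := @MVT_increment R (fun u => g (u, (t + h) * s))
  (fun u => partial false g (u, (t + h) * s)) t h
  (fun u => is_derive_slice1 (dg false (u, (t + h) * s))).
have [c2 c2t E2] := @MVT_increment R (fun v => g (t, v))
  (fun v => partial true g (t, v)) (t * s) (h * s)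
  (fun v => is_derive_slice2 (dg true (t, v))).
have -> : h^-1 *: ((G \o shift t) (h *: 1) - G t) =
    partial false g (c1, (t + h) * s) + s * partial true g (t, c2).
  rewrite /G /= [h *: 1]mulr1 [h + t]addrC.
  have -> : g (t + h, (t + h) * s) - g (t, t * s) =
      partial false g (c1, (t + h) * s) * h + partial true g (t, c2) * (h * s).
    by rewrite -E1 -E2 -mulrDl; ring.
  by rewrite /GRing.scale/=; field.
rewrite /L opprD addrACA -mulrBr (le_trans (ler_normD _ _))// normrM.
have -> : e = e / (1 + `|s|) + `|s| * (e / (1 + `|s|)).
  by field; rewrite gt_eqF.
rewrite lerD ?ler_wpM2l//.
  apply: D1; first exact: le_lt_trans hd1.
  by rewrite mulrDl addrAC subrr add0r.
by apply: D2; rewrite ?subrr ?normr0// (le_lt_trans c2t).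
Unshelve. all: by end_near. Qed.

End plane_calculus.

(** * The field psi *)

Section euclidean_norm.
Context {R : realType}.
Implicit Types x y : R * R.

Lemma enorm_ge0 x : 0 <= enorm x. Proof. exact: sqrtr_ge0. Qed.

Lemma sqr_enorm x : enorm x ^+ 2 = x.1 ^+ 2 + x.2 ^+ 2.
Proof. by rewrite sqr_sqrtr// addr_ge0// sqr_ge0. Qed.

Lemma enormZ (c : R) x : enorm (c *: x) = `|c| * enorm x.
Proof. by rewrite /enorm /= !exprMn -mulrDr sqrtrM ?sqr_ge0// sqrtr_sqr. Qed.

Lemma ler_enorm1 x : `|x.1| <= enorm x.
Proof. by rewrite -sqrtr_sqr ler_wsqrtr// lerDl sqr_ge0. Qed.

Lemma ler_enorm2 x : `|x.2| <= enorm x.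
Proof. by rewrite -sqrtr_sqr ler_wsqrtr// lerDr sqr_ge0. Qed.

Lemma enorm_dot x y : `|x.1 * y.1 + x.2 * y.2| <= enorm x * enorm y.
Proof.
rewrite -[leLHS]sqrtr_sqr /enorm -sqrtrM ?addr_ge0 ?sqr_ge0// ler_wsqrtr//.
by rewrite -subr_ge0 (_ : _ - _ = (x.1 * y.2 - x.2 * y.1) ^+ 2) ?sqr_ge0//; ring.
Qed.

Lemma ler_enormD x y : enorm (x + y) <= enorm x + enorm y.
Proof.
rewrite -(ler_pXn2r (n := 2)) ?nnegrE ?addr_ge0 ?enorm_ge0// sqrrD !sqr_enorm /=.
have := le_trans (ler_norm _) (enorm_dot x y); lra.
Qed.

Lemma enorm_gt0 x : x != 0 -> 0 < enorm x.
Proof.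
move=> x0; rewrite sqrtr_gt0 lt_def addr_ge0 ?sqr_ge0// andbT.
by rewrite paddr_eq0 ?sqr_ge0// !sqrf_eq0 -[_ && _]/(x == 0).
Qed.

Lemma measurable_enorm : measurable_fun setT (enorm : plane R -> R).
Proof.
apply: (@measurableT_comp _ _ _ (plane R) R R (@Num.sqrt R)).
  by apply: continuous_measurable_fun; exact: sqrt_continuous.
by apply: measurable_funD; apply: measurable_funX; [exact: measurable_fst|exact: measurable_snd].
Qed.

End euclidean_norm.

Section fundamental_field.
Context {R : realType}.
Implicit Types x : R * R.

Lemma enorm_psi x : enorm (psi x) = (2 * pi)^-1 * (enorm x)^-1.
Proof.
(* At the origin both sides are 0, because the inverse of 0 is 0. *)
have [x0|x0] := eqVneq (enorm x) 0.
  by rewrite /psi x0 expr0n invr0 scale0r scaler0 /enorm /= expr0n addr0 sqrtr0 mulr0.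
rewrite /psi !enormZ ger0_norm ?invr_ge0 ?mulr_ge0 ?pi_ge0//.
by rewrite ger0_norm ?invr_ge0 ?sqr_ge0//; congr (_ * _); field.
Qed.

Lemma psi1E x : (psi x).1 = (2 * pi)^-1 * ((enorm x ^+ 2)^-1 * x.1).
Proof. by []. Qed.

Lemma psi2E x : (psi x).2 = (2 * pi)^-1 * ((enorm x ^+ 2)^-1 * x.2).
Proof. by []. Qed.

Lemma measurable_inv_real : measurable_fun setT (fun t : R => t^-1).
Proof.
rewrite (_ : (fun t => _) = fun t : R => if t == 0 then 0 else t^-1); last first.
  by apply/funext => t; case: eqP => // ->; rewrite invr0.
apply: measurable_fun_if => //; first exact: measurable_fun_eqr.
apply: (@measurable_funS _ _ _ _ [set t : R | t != 0]).
- apply: open_measurable; rewrite (_ : [set t : R | _] = ~` [set 0]).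
    exact/closed_openC/closed_eq.
  by apply/seteqP; split => t /eqP.
- by move=> t/= [_ ->].
apply: open_continuous_measurable_fun => [|t].
  rewrite (_ : [set t : R | _] = ~` [set 0]).
    exact/closed_openC/closed_eq.
  by apply/seteqP; split => t /eqP.
by rewrite inE/= => t0; exact: inv_continuous.
Qed.

Lemma measurable_psi : measurable_fun setT (psi : plane R -> plane R).
Proof.
have mi : measurable_fun setT (fun x : plane R => (enorm x ^+ 2)^-1).
  apply: (measurableT_comp measurable_inv_real).
  by apply: measurable_funX; exact: measurable_enorm.
apply: measurable_fun_pair; apply: (@measurable_funM _ (plane R) R) => //;
  exact: (@measurable_funM _ (plane R) R).
Qed.

Lemma measurable_enorm_psi : measurable_fun setT (fun x : plane R => enorm (psi x)).
Proof. exact: measurableT_comp measurable_enorm measurable_psi. Qed.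

(* Dyadic shells: each square of half-side r/2^k carries the size of 1/|x| on
   the shell between r/2^(k+1) and r/2^k. *)
Lemma inv_enorm_dyadic (r : R) x : 0 < r ->
  (((enorm x)^-1)%:E <= (2 / r)%:E + \sum_(0 <= k <oo)
     (2 ^+ k.+1 / r * \1_([set y | `|y.1| <= r / 2 ^+ k] `&`
                          [set y | `|y.2| <= r / 2 ^+ k]) x)%:E)%E.
Proof.
move=> r0.
have s0 k : (0 <= (2 ^+ k.+1 / r * \1_([set y : R * R | `|y.1| <= r / 2 ^+ k] `&`
                          [set y | `|y.2| <= r / 2 ^+ k]) x)%:E)%E.
  by rewrite lee_fin mulr_ge0// divr_ge0 ?exprn_ge0// ltW.
have [x0|x0] := eqVneq (enorm x) 0.
  rewrite x0 invr0 adde_ge0 ?nneseries_ge0// lee_fin divr_ge0// ltW//.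
have x_gt0 : 0 < enorm x by rewrite lt_def x0 enorm_ge0.
have ex : exists k, r / 2 ^+ k.+1 <= enorm x.
  have := archi_boundP (divr_ge0 (ltW r0) (ltW x_gt0)).
  set k := Num.bound _ => rk; exists k.
  rewrite ler_pdivrMr ?exprn_gt0// mulrC -ler_pdivrMr// (le_trans (ltW rk))//.
  by rewrite -natrX ler_nat (leq_trans (ltnW (ltn_expl k (ltnSn 1))))// leq_exp2l.
(* The least index locates the shell of [x]. If it is 0 then |x| >= r/2 and the term 2/r suffices;
   otherwise minimality puts [x] in the square of that index, whose weight dominates 1/|x|. *)
case: (ex_minnP ex) => -[|k] kx kmin.
  rewrite (@le_trans _ _ (2 / r)%:E)//; last by rewrite leeDl// nneseries_ge0.
  rewrite lee_fin -[leRHS]invrK lef_pV2 ?posrE// ?invr_gt0 ?divr_gt0//.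
  by rewrite invf_div -[2]expr1.
rewrite (@le_trans _ _ (2 ^+ k.+2 / r)%:E)//.
  rewrite lee_fin -[leRHS]invrK lef_pV2 ?posrE ?invr_gt0 ?divr_gt0 ?exprn_gt0//.
  by rewrite invf_div.
have xk : enorm x <= r / 2 ^+ k.+1.
  by rewrite leNgt; apply/negP => /ltW /kmin; rewrite ltnn.
rewrite (@le_trans _ _ (2 ^+ k.+2 / r * \1_([set y : R * R | `|y.1| <= r / 2 ^+ k.+1] `&`
                          [set y | `|y.2| <= r / 2 ^+ k.+1]) x)%:E)//.
  rewrite indicE mem_set ?mulr1//; split => /=.
    exact: le_trans (ler_enorm1 x) xk.
  exact: le_trans (ler_enorm2 x) xk.
apply: (@le_trans _ _ (\sum_(0 <= j < k.+2)
  (2 ^+ j.+1 / r * \1_([set y | `|y.1| <= r / 2 ^+ j] `&`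
                          [set y | `|y.2| <= r / 2 ^+ j]) x)%:E)%E).
  by rewrite big_nat_recr//= leeDr// sume_ge0.
apply: (le_trans (nneseries_lim_ge _ _)) => [k0 _ _|]; first exact: s0.
by rewrite leeDr// lee_fin divr_ge0// ltW.
Qed.

End fundamental_field.

(** * The kernel [psi] lies in weak L^2 *)

Section weak_bound.
Context {R : realType}.
Local Notation mu := (@lebesgue_measure R).

Lemma nneseries_halves (c : R) : 0 <= c ->
  (\sum_(0 <= k <oo) (c / 2 ^+ k)%:E <= (2 * c)%:E)%E.
Proof.
move=> c0.
apply: lime_le => [|]; first by apply: is_cvg_nneseries => n _ _; rewrite lee_fin divr_ge0 ?exprn_ge0.
apply: nearW => n; rewrite sumEFin lee_fin.
suff -> : \sum_(0 <= k < n) (c / 2 ^+ k) = 2 * c - 2 * c / 2 ^+ n.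
  by rewrite gerBl divr_ge0 ?mulr_ge0 ?exprn_ge0.
elim: n => [|n IH]; first by rewrite big_nil expr0 divr1 subrr.
rewrite big_nat_recr//= IH exprS.
have : 2 ^+ n != 0 :> R by rewrite expf_neq0.
by move=> ?; field.
Qed.

Lemma leb2_square (d : R) : 0 <= d ->
  leb2 R ([set y | `|y.1| <= d] `&` [set y | `|y.2| <= d]) = ((2 * d) ^+ 2)%:E.
Proof.
move=> d0; rewrite (_ : _ `&` _ = `[- d, d]%classic `*` `[- d, d]%classic); last first.
  by apply/seteqP; split => -[x y] /=; rewrite !in_itv/= -!ler_norml.
rewrite leb2_setX ?lebesgue_measure_itv/= ?lte_fin; [|exact: measurable_itv..].
case: ifPn => [_|]; first by rewrite -EFinB -EFinM; congr EFin; ring.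
rewrite -leNgt => d0'; have -> : d = 0 by apply/eqP; rewrite eq_le d0 andbT; lra.
by rewrite mulr0 expr0n mule0.
Qed.

Lemma measurable_square (d : R) :
  @measurable _ (plane R) ([set y | `|y.1| <= d] `&` [set y | `|y.2| <= d]).
Proof.
rewrite (_ : _ `&` _ = `[- d, d]%classic `*` `[- d, d]%classic); last first.
  by apply/seteqP; split => -[x y] /=; rewrite !in_itv/= -!ler_norml.
by apply: measurableX; exact: measurable_itv.
Qed.

(** The square of index k has area 4 r^2/4^k and weight 2^(k+1)/r, so it contributes at most 8r/2^k,
    and the geometric sum is 16r. The constant term 2/r is integrated over [E]. The scale [r] stays
    free, to be adapted to [E]. *)
Lemma integral_inv_enorm_le (E : set (plane R)) (r : R) : measurable E -> 0 < r ->
  (\int[leb2 R]_(x in E) ((enorm x)^-1)%:E <= (2 / r)%:E * leb2 R E + (16 * r)%:E)%E.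
Proof.
move=> mE r0.
pose B k : set (plane R) := [set y | `|y.1| <= r / 2 ^+ k] `&` [set y | `|y.2| <= r / 2 ^+ k].
have mB k : measurable (B k) by exact: measurable_square.
pose s k (x : plane R) := (2 ^+ k.+1 / r * \1_(B k) x)%:E.
have c0 k : 0 <= 2 ^+ k.+1 / r by rewrite divr_ge0 ?exprn_ge0// ltW.
have s0 k x : (0 <= s k x)%E by rewrite lee_fin mulr_ge0.
have ms k : measurable_fun setT (s k).
  by apply/measurable_EFinP; apply: measurable_funM => //; exact: measurable_indic.
have mi : measurable_fun setT (fun x : plane R => ((enorm x)^-1)%:E).
  by apply/measurable_EFinP; exact: (measurableT_comp measurable_inv_real measurable_enorm).
have mS : measurable_fun setT (fun x => \sum_(0 <= k <oo) s k x)%E.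
  by apply: ge0_emeasurable_sum.
apply: (@le_trans _ _ (\int[leb2 R]_(x in E) ((2 / r)%:E + \sum_(0 <= k <oo) s k x))%E).
  apply: ge0_le_integral => //.
  - by move=> x _; rewrite lee_fin invr_ge0 enorm_ge0.
  - exact: measurable_funTS.
  - by apply: emeasurable_funD => //; exact: measurable_funTS.
  - by move=> x _; exact: inv_enorm_dyadic.
rewrite ge0_integralD//; last 3 first.
- by move=> x _; rewrite lee_fin divr_ge0// ltW.
- by move=> x _; exact: nneseries_ge0.
- exact: measurable_funTS.
rewrite integral_cst// leeD2l// integral_nneseries//; last first.
  by move=> k; exact: measurable_funTS.
apply: (@le_trans _ _ (\sum_(0 <= k <oo) (8 * r / 2 ^+ k)%:E)%E); last first.
  have -> : 16 * r = 2 * (8 * r) by ring.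
  by apply: nneseries_halves; rewrite mulr_ge0// ltW.
apply: lee_nneseries => [k _ _|k _]; first by apply: integral_ge0.
apply: (@le_trans _ _ (\int[leb2 R]_x s k x)%E).
  by apply: ge0_subset_integral.
rewrite /s; under eq_integral do rewrite EFinM.
rewrite ge0_integralZl ?lee_fin//; last first.
  by apply/measurable_EFinP; exact: measurable_indic.
have rk0 : 0 <= r / 2 ^+ k by rewrite divr_ge0 ?exprn_ge0// ltW.
rewrite integral_indic// setIT leb2_square// -EFinM lee_fin exprS.
have k0 : 2 ^+ k != 0 :> R by rewrite expf_neq0.
rewrite le_eqVlt; apply/orP; left; apply/eqP; field.
by rewrite k0 gt_eqF.
Qed.

(** The scale r = |E|^(1/2) turns both terms of [integral_inv_enorm_le] into multiples of |E|^(1/2),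
    whence 18 = 2 + 16. The aim is finiteness of the weak norm; its exact value enters the theorem
    through [weakL2norm]. *)
Lemma psi_weakL2 : exists K : R, forall E : set (plane R), measurable E -> (leb2 R E < +oo)%E ->
  (\int[leb2 R]_(x in E) (enorm (psi x))%:E <= K%:E * leb2 R E `^ 2^-1%R)%E.
Proof.
pose K0 : R := (2 * pi)^-1.
have K00 : 0 <= K0 by rewrite invr_ge0 mulr_ge0// pi_ge0.
exists (K0 * 18) => E mE Eoo.
have mi : measurable_fun E (fun x : plane R => ((enorm x)^-1)%:E).
  apply: measurable_funTS.
  by apply/measurable_EFinP; exact: (measurableT_comp measurable_inv_real measurable_enorm).
under eq_integral do rewrite enorm_psi EFinM.
rewrite ge0_integralZl ?lee_fin//; last by move=> x _; rewrite lee_fin invr_ge0 enorm_ge0.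
rewrite EFinM -muleA lee_wpmul2l//.
have [c c0 cE] : exists2 c, 0 <= c & leb2 R E = c%:E.
  exists (fine (leb2 R E)); first by rewrite fine_ge0.
  by rewrite fineK// ge0_fin_numE.
have [c_eq0|c_neq0] := eqVneq c 0.
  by rewrite null_set_integral ?cE ?c_eq0// mule_ge0// poweR_ge0.
have r0 : 0 < Num.sqrt c by rewrite sqrtr_gt0 lt_def c_neq0.
rewrite (le_trans (integral_inv_enorm_le mE r0))// cE poweR_EFin powR12_sqrt//.
rewrite -!EFinM -EFinD lee_fin.
have -> : 2 / Num.sqrt c * c = 2 * Num.sqrt c.
  by rewrite -{2}(sqr_sqrtr c0); field; rewrite gt_eqF.
by rewrite -mulrDl; lra.
Qed.

End weak_bound.

(** * The divergence of [psi] is the Dirac mass *)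

Section fundamental_solution.
Context {R : realType}.
Local Notation mu := (@lebesgue_measure R).
Implicit Types f : R * R -> R.

Definition psi_grad f (z : plane R) : R :=
  (psi z).1 * partial false f z + (psi z).2 * partial true f z.

Lemma integralT_oneDsqrV : (\int[mu]_s ((1 + s ^+ 2)^-1)%:E = pi%:E :> \bar R)%E.
Proof.
rewrite (@ge0_symfun_integralT R (fun s => (1 + s ^+ 2)^-1)).
- rewrite -set_itvcy; have := @integral0y_oneDsqr R; rewrite /oneDsqr => ->.
  by rewrite -EFinM; congr EFin; field.
- by move=> s; rewrite invr_ge0 addr_ge0// sqr_ge0.
- exact: continuous_oneDsqrV.
- by move=> s /=; rewrite sqrrN.
Qed.

Lemma psi_locally_integrable (E : set (plane R)) : measurable E ->
  (leb2 R E < +oo)%E -> (\int[leb2 R]_(x in E) (enorm (psi x))%:E < +oo)%E.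
Proof.
move=> mE Eoo; have [K KE] := @psi_weakL2 R.
apply: le_lt_trans (KE E mE Eoo) _.
by rewrite -(@fineK _ (leb2 R E)) ?ge0_fin_numE// poweR_EFin -EFinM ltry.
Qed.

Lemma measurable_psi_grad f : C1c f -> measurable_fun setT (psi_grad f).
Proof.
move=> Cf; have [m1 m2] := (measurable_fun_pairP _).1 (@measurable_psi R).
by apply: measurable_funD; apply: measurable_funM => //; exact: C1c_partial_measurable.
Qed.

(** The partials of [f] are bounded and supported in a square, over which the singularity of [psi]
    is integrable by the weak bound. *)
Lemma psi_grad_integrable f : C1c f -> (leb2 R).-integrable setT (EFin \o psi_grad f).
Proof.
move=> Cf; have mG := measurable_psi_grad Cf.
have [N [M [N0 _ fN _ fM]]] := C1c_partial_bound Cf.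
have M0 : 0 <= M by apply: le_trans (fM false 0).
pose B : set (plane R) := [set y | `|y.1| <= N] `&` [set y | `|y.2| <= N].
have mB : measurable B by exact: measurable_square.
apply: (@eq_integrable _ _ _ _ setT measurableT ((EFin \o psi_grad f) \_ B)).
  move=> x _; rewrite /patch; case: ifPn => //; rewrite notin_setE => xB.
  rewrite /= /psi_grad !fN ?mulr0 ?addr0//;
  by apply/negbNE; rewrite negb_or -!ltNge; apply/negP => /andP[/ltW x1 /ltW x2]; apply: xB.
apply: (iffLR (integrable_mkcond _ mB)).
apply/integrableP; split; first by apply/measurable_EFinP; exact: measurable_funTS.
apply: (@le_lt_trans _ _ (\int[leb2 R]_(x in B) ((2 * M)%:E * (enorm (psi x))%:E))%E).
  apply: ge0_le_integral => //.
  - by apply: measurableT_comp => //; apply/measurable_EFinP; exact: measurable_funTS.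
  - apply/measurable_EFinP; apply: measurable_funM => //.
    by apply: measurable_funTS; exact: measurable_enorm_psi.
  move=> x _; rewrite lee_fin /psi_grad.
  have h1 : `|(psi x).1 * partial false f x| <= enorm (psi x) * M.
    by rewrite normrM ler_pM// ler_enorm1.
  have h2 : `|(psi x).2 * partial true f x| <= enorm (psi x) * M.
    by rewrite normrM ler_pM// ler_enorm2.
  have -> : 2 * M * enorm (psi x) = enorm (psi x) * M + enorm (psi x) * M by ring.
  exact: le_trans (ler_normD _ _) (lerD h1 h2).
rewrite ge0_integralZl ?lee_fin ?mulr_ge0//; last 2 first.
- by apply/measurable_EFinP; apply: measurable_funTS; exact: measurable_enorm_psi.
- by move=> x _; rewrite lee_fin enorm_ge0.
rewrite lte_mul_pinfty ?lee_fin ?mulr_ge0// psi_locally_integrable//.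
by rewrite leb2_square ?ltry// ltW.
Qed.

Lemma psi_grad_slope f (x s : R) :
  `|x| * psi_grad f (x, x * s) = Num.sg x * ((2 * pi)^-1 * (1 + s ^+ 2)^-1 *
     (partial false f (x, x * s) + s * partial true f (x, x * s))).
Proof.
rewrite /psi_grad psi1E psi2E sqr_enorm /=; set P := (2 * pi)^-1.
have [->|x0] := eqVneq x 0; first by rewrite normr0 sgr0 !mul0r.
have s0 : 1 + s ^+ 2 != 0 by rewrite gt_eqF// ltr_pwDl// sqr_ge0.
have q0 : x ^+ 2 + (x * s) ^+ 2 != 0.
  by rewrite (_ : _ + _ = x ^+ 2 * (1 + s ^+ 2)) ?mulf_neq0 ?expf_neq0//; ring.
by rewrite normrEsg; field; rewrite ?s0 ?x0 ?q0.
Qed.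

Lemma integral_psi_grad f : C1c f ->
  (\int[leb2 R]_z (psi_grad f z)%:E = (- f (0, 0))%:E)%E.
Proof.
move=> Cf; have mG : measurable_fun setT (EFin \o psi_grad f).
  by apply/measurable_EFinP; exact: measurable_psi_grad.
have [N [M [N0 fN dfN _ _]]] := C1c_partial_bound Cf.
pose H (z : plane R) := (`|z.1|%R%:E * (psi_grad f (z.1, z.1 * z.2)%R)%:E)%E.
have iH : (leb2 R).-integrable setT H.
  have /integrableP[_ iG] := psi_grad_integrable Cf.
  have mA : measurable_fun setT (fun z : plane R => `|(psi_grad f z)%:E|%E).
    exact: measurableT_comp.
  apply/integrableP; split; first exact: measurable_plane_slope mG.
  move: iG; rewrite -(integral_plane_slope mA); congr (_ < _)%E.
  by apply: eq_integral => z _; rewrite /H abseM /= normr_id.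
(* The integral in x comes first, at fixed slope: every curve x |-> (x, x s) passes through the
   origin at x = 0, so the same value [f (0, 0)] comes out for all slopes. *)
rewrite -(integral_plane_slope mG) -[LHS](integral21_prod_meas1 iH).
transitivity (\int[mu]_s ((- (2 * ((2 * pi)^-1 * f (0, 0))))%:E * ((1 + s ^+ 2)^-1)%:E))%E.
  apply: eq_integral => s _; rewrite /fubini_G /H.
  pose c := (2 * pi)^-1 * (1 + s ^+ 2)^-1 : R.
  under eq_integral do rewrite -EFinM /= psi_grad_slope -/c.
  have dF x : is_derive x (1 : R) (fun x => c * f (x, x * s))
      (c * (partial false f (x, x * s) + s * partial true f (x, x * s))).
    by have h := is_derive_slope s x Cf; exact: (@is_deriveZ _ _ _ _ c _ _ _ h).
  rewrite (integral_sg_deriv N0 dF).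
  - by rewrite mul0r -EFinM; congr EFin; rewrite /c; ring.
  - have [_ _ cdf _] := Cf.
    have cs : continuous (fun x : R => (x, x * s)).
      apply: continuous_pair => x; first exact: cvg_id.
      by apply: cvgM; [exact: cvg_id|exact: cvg_cst].
    have cfs i : continuous (fun x : R => partial i f (x, x * s)).
      by move=> x; exact: (@continuous_comp _ _ _ (fun x : R => (x, x * s)) (partial i f) x (cs x) (cdf _ _)).
    move=> x; apply: (cvgM (cvg_cst c)).
    exact: (cvgD (cfs false x) (cvgM (cvg_cst s) (cfs true x))).
  - by move=> x xN; rewrite fN ?mulr0//= xN.
rewrite integralZl//; last first.
  apply/integrableP; split.
    by apply/measurable_EFinP; apply: continuous_measurable_fun; exact: continuous_oneDsqrV.
  under eq_integral => s _ do rewrite gee0_abs ?lee_fin ?invr_ge0 ?addr_ge0 ?sqr_ge0//.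
  by rewrite integralT_oneDsqrV ltry.
rewrite integralT_oneDsqrV -EFinM; congr EFin.
have : pi != 0 :> R by rewrite gt_eqF// pi_gt0.
by move: (f (0, 0)) (pi : R) => v p p0; field.
Qed.

Lemma growth_rate_shift f (y z v : R * R) :
  (fun h : R => h^-1 *: (((fun z => f (y + z)) \o shift z) (h *: v) - f (y + z))) =
  (fun h : R => h^-1 *: ((f \o shift (y + z)) (h *: v) - f (y + z))).
Proof. by apply/funext => h; rewrite /= addrCA. Qed.

Lemma partial_shift f i (y z : R * R) :
  partial i (fun z => f (y + z)) z = partial i f (y + z).
Proof. by rewrite /partial /derive growth_rate_shift. Qed.

Lemma C1c_shift f (y : R * R) : C1c f -> C1c (fun z => f (y + z)).
Proof.
move=> [cf df cdf [N N0 fN]].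
have cy : continuous (fun z : R * R => y + z) by move=> z; apply: cvgD; [exact: cvg_cst|exact: cvg_id].
split.
- by move=> z; exact: (@continuous_comp _ _ _ (fun z => y + z) f z (cy z) (cf _)).
- by move=> i z; rewrite /derivable growth_rate_shift; exact: df.
- move=> i; have -> : partial i (fun z => f (y + z)) = (fun z => partial i f (y + z)).
    by apply/funext => z; exact: partial_shift.
  by move=> z; exact: (@continuous_comp _ _ _ (fun z => y + z) (partial i f) z (cy z) (cdf _ _)).
exists (N + `|y.1| + `|y.2|) => [|z zN]; first by rewrite !ltr_wpDr.
apply: fN => /=; apply/orP; case/orP: zN => zN; [left|right].
  have := lerB_normD z.1 y.1; rewrite [z.1 + _]addrC; have := normr_ge0 y.2; lra.
have := lerB_normD z.2 y.2; rewrite [z.2 + _]addrC; have := normr_ge0 y.1; lra.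
Qed.

End fundamental_solution.

(** * Layer cake bound for the potential *)

Section translation.
Context {R : realType}.

Lemma measurable_sub_plane :
  measurable_fun setT (fun z : plane R * plane R => (z.1 - z.2 : plane R)).
Proof.
have [m1 m2] := (measurable_fun_pairP _).1 (@measurable_fst _ _ (plane R) (plane R)).
have [n1 n2] := (measurable_fun_pairP _).1 (@measurable_snd _ _ (plane R) (plane R)).
by apply: measurable_fun_pair; apply: (@measurable_funB _ _ R).
Qed.

Lemma measurable_subl (x : plane R) : measurable_fun setT (fun z : plane R => (x - z : plane R)).
Proof.
rewrite (_ : (fun z => _) = (fun z => (x.1 + -1 * z.1, x.2 + -1 * z.2))).
  exact: measurable_affine_plane.
by apply/funext => z; rewrite !mulN1r.
Qed.

Lemma integral_subl (x : plane R) (f : plane R -> \bar R) : measurable_fun setT f ->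
  (\int[leb2 R]_z f (x - z)%R = \int[leb2 R]_z f z)%E.
Proof.
move=> mf; rewrite -(@integral_plane_isometry R x (-1) f) ?normrN1//.
by apply: eq_integral => z _; rewrite !mulN1r.
Qed.

Lemma integral_addl (x : plane R) (f : plane R -> \bar R) : measurable_fun setT f ->
  (\int[leb2 R]_z f (x + z)%R = \int[leb2 R]_z f z)%E.
Proof.
move=> mf; rewrite -(@integral_plane_isometry R x 1 f) ?normr1//.
by apply: eq_integral => z _; rewrite !mul1r.
Qed.

Lemma integral_subr (x : plane R) (f : plane R -> \bar R) : measurable_fun setT f ->
  (\int[leb2 R]_z f (z - x)%R = \int[leb2 R]_z f z)%E.
Proof.
move=> mf; rewrite -(integral_addl (- x) mf).
by apply: eq_integral => z _; rewrite addrC.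
Qed.

End translation.

Section layer_cake.
Context {R : realType}.
Local Notation mu := (@lebesgue_measure R).

Definition weak_bound (w : R * R -> R * R) (K : R) :=
  forall E : set (plane R), measurable E -> (leb2 R E < +oo)%E ->
      (\int[leb2 R]_(x in E) (enorm (w x))%:E <= K%:E * leb2 R E `^ 2^-1%R)%E.

(** The reflection z |-> x - z preserves Lebesgue measure, so the estimate for the kernel centred at
    [x] is the weak bound on the set x - E. *)
Lemma psi_translate_weak_bound (K : R) (x : plane R) (E : set (plane R)) :
  weak_bound psi K -> measurable E -> (leb2 R E < +oo)%E ->
  (\int[leb2 R]_y (enorm (psi (x - y)) * \1_E y)%:E <= K%:E * leb2 R E `^ 2^-1%R)%E.
Proof.
move=> wK mE Eoo.
pose E' : set (plane R) := (fun z => x - z) @^-1` E.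
have mE' : measurable E' by rewrite -[E']setTI; exact: measurable_subl.
have EE' : leb2 R E' = leb2 R E.
  have lebE (A : set (plane R)) : measurable A -> leb2 R A = (\int[leb2 R]_z (\1_A z)%:E)%E.
    by move=> mA; rewrite integral_indic// setIT.
  rewrite !lebE// -(integral_subl x (f := fun z => (\1_E z)%:E)).
    by apply: eq_integral => z _; rewrite !indicE.
  by apply/measurable_EFinP; exact: measurable_indic.
rewrite -EE'; apply: le_trans (wK E' mE' _); last by rewrite EE'.
rewrite [leRHS](_ : _ = \int[leb2 R]_z (enorm (psi z) * \1_E (x - z))%:E)%E; last first.
  rewrite integral_mkcond; apply: eq_integral => z _.
  by rewrite /patch indicE -[x - z \in E]/(z \in E'); case: ifPn => _; rewrite ?mulr1 ?mulr0.
rewrite le_eqVlt; apply/orP; left; apply/eqP.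
rewrite -(integral_subl x (f := fun z => (enorm (psi z) * \1_E (x - z))%:E)).
  by apply: eq_integral => z _; rewrite subKr.
apply/measurable_EFinP; apply: measurable_funM; first exact: measurable_enorm_psi.
apply: (@measurableT_comp _ _ _ (plane R) (plane R) R (\1_E)); first exact: measurable_indic.
exact: measurable_subl.
Qed.

Lemma layer_cake (h : R) : (`|h|%:E = \int[mu]_(t in `]0%R, +oo[) (\1_[set t | t < `|h|] t)%:E)%E.
Proof.
rewrite integral_indic; last 2 first.
- exact: measurable_itv.
- rewrite (_ : [set t | _] = `]-oo, `|h|[%classic); first exact: measurable_itv.
  by apply/seteqP; split => t /=; rewrite in_itv.
rewrite (_ : _ `&` _ = `]0, `|h|[%classic); last first.
  by apply/seteqP; split => t /=; rewrite !in_itv/= andbT; [move=> [-> ->]|move=> /andP[]].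
apply/esym; apply: etrans; first exact: lebesgue_measure_itv.
rewrite /= lte_fin; case: ifPn; first by rewrite sube0.
by rewrite -leNgt => h0; congr EFin; apply/eqP; rewrite eq_le h0 normr_ge0.
Qed.

Lemma weak_bound_ge0 (w : R * R -> R * R) (K : R) : weak_bound w K -> 0 <= K.
Proof.
(* The square of half-side 1/2 has area 1, so on it the weak bound says that a nonnegative integral
   is at most [K]. *)
move=> wK; have := wK _ (measurable_square 2^-1); rewrite leb2_square ?invr_ge0//.
rewrite mulfV// expr1n ltry => /(_ isT) h; rewrite -lee_fin.
have -> : K%:E = (K%:E * 1%:E `^ 2^-1%R)%E by rewrite poweR_EFin powR1 mule1.
by apply: le_trans h; apply: integral_ge0 => x _; rewrite lee_fin enorm_ge0.
Qed.

Variables (K : R) (r : plane R -> R).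
Hypotheses (wK : weak_bound psi K) (mr : measurable_fun setT r).
Hypothesis r_fin : forall t : R, 0 < t -> (leb2 R [set x | (t < `|r x|)%R] < +oo)%E.

Let mlevel : measurable_fun setT (fun z : plane R * measurableTypeR R => (\1_[set t : R | t < `|r z.1|] z.2 : R)).
Proof.
rewrite (_ : (fun z => _) = fun z : plane R * measurableTypeR R => if z.2 < `|r z.1| then 1 else 0).
  apply: measurable_fun_ifT => //; apply: measurable_fun_ltr; first exact: measurable_snd.
  apply: (@measurableT_comp _ _ _ _ R) => //.
  by apply: (measurableT_comp mr); exact: measurable_fst.
apply/funext => z; rewrite indicE; case: ifPn => h.
  by rewrite mem_set.
by rewrite memNset//=; apply/negP.
Qed.

(** Duality between L^{2,1} and weak L^2: |r(y)| is the integral over t > 0 of the indicator of t <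
    |r(y)|, Tonelli exchanges the two integrals, and the weak bound applies on each level set, of
    finite measure by [r_fin]. The division of [K] by 2 undoes the factor 2 in [lorentz21]. *)
Lemma convolution_bound (x : plane R) :
  (\int[leb2 R]_y (enorm (psi (x - y)) * `|r y|)%:E <= (K / 2)%:E * lorentz21 r)%E.
Proof.
have mpsi : measurable_fun setT (fun y : plane R => enorm (psi (x - y))).
  exact: (measurableT_comp (@measurable_enorm_psi R) (measurable_subl x)).
pose pos : set (measurableTypeR R) := `]0%R, +oo[%classic.
have mpos : measurable pos by exact: measurable_itv.
pose G (z : plane R * measurableTypeR R) :=
  (enorm (psi (x - z.1)) * (\1_[set t : R | t < `|r z.1|] z.2 * \1_pos z.2))%:E.
have G0 z : (0 <= G z)%E by rewrite lee_fin mulr_ge0 ?enorm_ge0// mulr_ge0.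
have mG : measurable_fun setT G.
  apply/measurable_EFinP; apply: measurable_funM.
    by apply: (measurableT_comp mpsi); exact: measurable_fst.
  apply: measurable_funM => //.
  apply: (@measurableT_comp _ _ _ _ (measurableTypeR R) R (\1_pos)); first exact: measurable_indic.
  exact: measurable_snd.
have mlv t : measurable ([set x | t < `|r x|] : set (plane R)).
  rewrite -[X in measurable X]setTI.
  have mr' : measurable_fun setT (fun x : plane R => `|r x|) by exact: measurableT_comp.
  rewrite (_ : [set x | _] = (fun x : plane R => `|r x|) @^-1` `]t, +oo[).
    by apply: mr' => //; exact: measurable_itv.
  by apply/seteqP; split => y /=; rewrite in_itv/= andbT.
have level_meas : measurable_fun setT (fun t : measurableTypeR R => leb2 R [set x | (t < `|r x|)%R]).
  have ml : measurable_fun setT (fun z : plane R * measurableTypeR R =>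
      (\1_[set t : R | t < `|r z.1|] z.2 : R)%:E).
    by apply/measurable_EFinP; exact: mlevel.
  have ml0 (z : plane R * measurableTypeR R) : (0 <= (\1_[set t : R | t < `|r z.1|] z.2 : R)%:E)%E.
    by rewrite lee_fin.
  have := measurable_level ml ml0; congr (measurable_fun _ _); apply/funext => t /=.
  rewrite -[X in leb2 R X]setIT -integral_indic//.
have -> : (\int[leb2 R]_y (enorm (psi (x - y)) * `|r y|)%:E = \int[leb2 R]_y \int[mu]_t G (y, t))%E.
  apply: eq_integral => y _.
  rewrite EFinM layer_cake integral_mkcond -ge0_integralZl ?lee_fin ?enorm_ge0//; last 2 first.
  - apply/(measurable_restrictT _ mpos)/measurable_funTS/measurable_EFinP/measurable_indic.
    rewrite (_ : [set t | _] = `]-oo, `|r y|[%classic); first exact: measurable_itv.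
    by apply/seteqP; split => t /=; rewrite in_itv.
  - by move=> t _; rewrite /patch; case: ifPn; rewrite ?lee_fin.
  apply: eq_integral => t _; rewrite /G /patch /= [\1_pos _]indicE.
  by case: ifPn => tp; rewrite ?mulr1 ?mulr0 ?mule0//.
rewrite tonelli_level//.
have -> : (\int[mu]_t \int[leb2 R]_y G (y, t) = \int[mu]_(t in pos) \int[leb2 R]_y G (y, t))%E.
  rewrite [RHS]integral_mkcond; apply: eq_integral => t _; rewrite /patch.
  case: ifPn => // tpos; apply: integral0_eq => y _.
  by rewrite /G /= [\1_pos _]indicE (negbTE tpos) !mulr0.
rewrite /lorentz21 muleA -EFinM divfK//.
have K0 := weak_bound_ge0 wK.
rewrite -ge0_integralZl//; last 2 first.
- by apply: measurable_funTS; apply: (measurableT_comp (measurable_poweR _)).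
- by move=> t _; exact: poweR_ge0.
apply: ge0_le_integral => //.
- by move=> t _; apply: integral_ge0.
- by apply: measurable_funTS; exact: measurable_level.
- apply: emeasurable_funM => //; apply: measurable_funTS.
  exact: (measurableT_comp (measurable_poweR _)).
move=> t tpos; have t0 : 0 < t by move: tpos; rewrite /pos /= in_itv/= andbT.
apply: le_trans (psi_translate_weak_bound x wK (mlv t) (r_fin t0)).
rewrite le_eqVlt; apply/orP; left; apply/eqP; apply: eq_integral => y _.
by rewrite /G /= [\1_pos _]indicE mem_set// mulr1.
Qed.

End layer_cake.

(** * Test functions and the fundamental lemma of the calculus of variations *)

Section bump.
Context {R : realType}.

(** Linear combinations of these functions contain all derivatives of the classical exp(-1/u), so
    that smoothness reduces to closure of an explicit family. *)
Definition flat (k : nat) (u : R) : R :=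
  if 0 < u then u^-1 ^+ k * expR (- u^-1) else 0.

Lemma flatS k u : flat k u = u * flat k.+1 u.
Proof.
rewrite /flat; case: ifPn => u0; last by rewrite mulr0.
by rewrite exprS !mulrA mulfV ?gt_eqF// mul1r.
Qed.

Lemma flat0_ge0 u : 0 <= flat 0 u.
Proof. by rewrite /flat; case: ifPn => // _; rewrite expr0 mul1r expR_ge0. Qed.

Lemma flat0_le1 u : flat 0 u <= 1.
Proof.
rewrite /flat; case: ifPn => // u0; rewrite expr0 mul1r -expR0 ler_expR.
by rewrite oppr_le0 invr_ge0 ltW.
Qed.

(** The exponential of 1/u exceeds the term of degree k + 2 of its series. The quadratic factor left
    over makes the difference quotient at 0 tend to 0. *)
Lemma flat_bound k u : `|flat k u| <= k.+2`!%:R * u ^+ 2.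
Proof.
rewrite /flat; case: ifPn => u0; last by rewrite normr0 mulr_ge0// sqr_ge0.
have v0 : 0 < u^-1 by rewrite invr_gt0.
rewrite ger0_norm; last by rewrite mulr_ge0 ?expR_ge0// exprn_ge0// ltW.
have := @expR_ge1Dxn R u^-1 k.+1 (ltW v0).
move=> /(le_trans (ler_wpDl ler01 (lexx _))) h.
have F0 : k.+2`!%:R != 0 :> R by rewrite pnatr_eq0 -lt0n fact_gt0.
have E : u^-1 ^+ k = k.+2`!%:R * u ^+ 2 * (u^-1 ^+ k.+2 / k.+2`!%:R).
  rewrite !exprS; move: (_ ^+ k) (_%:R) F0 => w F F0.
  by field; rewrite F0 gt_eqF.
rewrite expRN ler_pdivrMr ?expR_gt0// [leLHS]E ler_wpM2l//.
by rewrite mulr_ge0// sqr_ge0.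
Qed.

Lemma is_derive_flat k u :
  is_derive u (1 : R) (flat k) (flat k.+2 u - k%:R * flat k.+1 u).
Proof.
have [u0|u0|->] := ltgtP u 0.
- have f0 m : flat m u = 0 by rewrite /flat ltNge ltW.
  rewrite !f0 mulr0 subr0.
  apply: (@near_eq_is_derive R R R (cst 0) (flat k) u 1 0).
  near=> v; rewrite /flat ltNge ltW//; near: v; exact: lt_nbhsl.
- pose f v : R := v^-1 ^+ k * expR (- v^-1).
  apply: (@near_eq_is_derive R R R f (flat k) u 1).
    near=> v; rewrite /flat/f ifT//; near: v; exact: lt_nbhsr.
  have u1 : u != 0 by rewrite gt_eqF.
  have dV : is_derive u (1 : R) (fun v : R => v^-1) (- u ^- 2 *: 1) by exact: is_deriveV.
  have dE : is_derive u (1 : R) (fun v : R => expR (- v^-1)) (expR (- u^-1) * - (- u ^- 2 *: 1)).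
    by apply: (@is_derive1_comp _ expR (fun v : R => - v^-1)).
  have dX : is_derive u (1 : R) (fun v : R => v^-1 ^+ k) ((k%:R * u^-1 ^+ k.-1) *: (- u ^- 2 *: 1)).
    by have := @is_deriveX _ _ _ k _ _ _ dV; rewrite exprfctE.
  apply: (is_derive_eq (is_deriveM dX dE)).
  rewrite /flat u0 /GRing.scale/=.
  case: k {f dX} => [|k]; first by rewrite /= !exprS !expr0; field.
  by rewrite /= !exprS; field.
- have f0 m : flat m 0 = 0 :> R by rewrite /flat ltxx.
  rewrite !f0 mulr0 subr0.
  suff c : (fun h : R => h^-1 *: ((flat k \o shift 0) (h *: 1) - flat k 0)) @ 0^' --> (0 : R).
    by split; [apply: cvgP c|exact: cvg_lim c].
  apply/cvgrPdist_le => e e0; near=> h.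
  have h0 : h != 0 by near: h; exact: nbhs_dnbhs_neq.
  rewrite /= [h *: 1]mulr1 addr0 f0 subr0 sub0r normrN normrZ normfV.
  rewrite ler_pdivrMl ?normr_gt0// (le_trans (flat_bound k h))//.
  rewrite -(ger0_norm (sqr_ge0 h)) normrX expr2 mulrA mulrC ler_wpM2l// -ler_pdivlMl ?ltr0n ?fact_gt0//.
  near: h; apply: dnbhs0_le; rewrite mulr_gt0// invr_gt0 ltr0n fact_gt0//.
Unshelve. all: by end_near. Qed.

Definition bump_fun (q p : {poly R}) (k : nat) (t : R) : R := p.[t] * flat k q.[t].

(** The numerator obtained when the derivative of p q^(-k) exp(-1/q) is written over q^(k+2);
    differentiation thus stays within the family [bump_fun q]. *)
Definition bump_deriv (q p : {poly R}) (k : nat) : {poly R} :=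
  p^`() * q ^+ 2 + p * q^`() - (p * q^`() * q) *+ k.

Lemma is_derive_bump q p k t :
  is_derive t (1 : R) (bump_fun q p k) (bump_fun q (bump_deriv q p k) k.+2 t).
Proof.
have dq := @is_derive1_comp _ (flat k) (horner q) t _ _ (is_derive_flat k _) (is_derive_poly q t).
apply: (is_derive_eq (is_deriveM (is_derive_poly p t) dq)).
rewrite /bump_fun /bump_deriv /GRing.scale/= !(hornerD, hornerM, hornerN, hornerMn, horner_exp).
by rewrite (flatS k) (flatS k.+1) -mulr_natl; ring.
Qed.

End bump.

Section bump_plane.
Context {R : realType}.

Lemma is_derive_tensor1 (f g : R -> R) (x : R * R) (df : R) :
  is_derive x.1 (1 : R) f df ->
  is_derive x (axis false) (fun z => f z.1 * g z.2) (df * g x.2).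
Proof.
move=> Df.
have E : (fun h : R => h^-1 *: (((fun z : R * R => f z.1 * g z.2) \o shift x) (h *: axis false) - f x.1 * g x.2)) =
    (fun h : R => h^-1 *: (((fun t : R => g x.2 * f t) \o shift x.1) (h *: 1) - g x.2 * f x.1)).
  apply/funext => h; rewrite /= [h *: 0]mulr0 add0r.
  by congr (_ *: (_ - _)); rewrite mulrC.
have [D1 D2] : is_derive x.1 (1 : R) (fun t : R => g x.2 * f t) (g x.2 * df).
  exact: (@is_deriveZ _ _ _ _ (g x.2) _ _ _ Df).
split; first by rewrite /derivable /= E.
by rewrite /derive E [RHS]mulrC.
Qed.

Lemma is_derive_tensor2 (f g : R -> R) (x : R * R) (dg : R) :
  is_derive x.2 (1 : R) g dg ->
  is_derive x (axis true) (fun z => f z.1 * g z.2) (f x.1 * dg).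
Proof.
move=> Dg.
have E : (fun h : R => h^-1 *: (((fun z : R * R => f z.1 * g z.2) \o shift x) (h *: axis true) - f x.1 * g x.2)) =
    (fun h : R => h^-1 *: (((fun t : R => f x.1 * g t) \o shift x.2) (h *: 1) - f x.1 * g x.2)).
  by apply/funext => h; rewrite /= [h *: 0]mulr0 add0r.
have [D1 D2] : is_derive x.2 (1 : R) (fun t : R => f x.1 * g t) (f x.1 * dg).
  exact: (@is_deriveZ _ _ _ _ (f x.1) _ _ _ Dg).
split; first by rewrite /derivable /= E.
by rewrite /derive E.
Qed.

(** A class stable under partials contains all iterated ones, so no formula for higher derivatives
    is required. *)
Lemma smooth_coind (S : set (R * R -> R)) :
  (forall g, S g -> continuous g) ->
  (forall g i x, S g -> derivable g x (axis i)) ->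
  (forall g i, S g -> S (partial i g)) -> forall g, S g -> smooth g.
Proof.
move=> Sc Sd Sp g Sg s /=.
have Ss : S (foldr partial g s) by elim: s => //= i s; exact: Sp.
by split => [|i x]; [exact: Sc|exact: Sd].
Qed.

Definition tensor_bump (q1 q2 p1 p2 : {poly R}) (k1 k2 : nat) (z : R * R) : R :=
  bump_fun q1 p1 k1 z.1 * bump_fun q2 p2 k2 z.2.

Lemma tensor_bump_smooth q1 q2 p1 p2 k1 k2 : smooth (tensor_bump q1 q2 p1 p2 k1 k2).
Proof.
pose S : set (R * R -> R) := [set g | exists p1 p2 k1 k2, g = tensor_bump q1 q2 p1 p2 k1 k2].
apply: (smooth_coind (S := S)); last by exists p1, p2, k1, k2.
- move=> _ [{}p1 [{}p2 [{}k1 [{}k2 ->]]]] z.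
  have cb (q p : {poly R}) k : continuous (bump_fun q p k).
    exact: (is_derive_continuous (fun t => is_derive_bump q p k t)).
  apply: cvgM.
    by apply: (@continuous_comp _ _ _ fst (bump_fun q1 p1 k1)); [exact: cvg_fst|exact: cb].
  by apply: (@continuous_comp _ _ _ snd (bump_fun q2 p2 k2)); [exact: cvg_snd|exact: cb].
- move=> _ [] x [{}p1 [{}p2 [{}k1 [{}k2 ->]]]].
    by have [] := is_derive_tensor2 (bump_fun q1 p1 k1) (is_derive_bump q2 p2 k2 x.2).
  by have [] := is_derive_tensor1 (bump_fun q2 p2 k2) (is_derive_bump q1 p1 k1 x.1).
- move=> _ [] [{}p1 [{}p2 [{}k1 [{}k2 ->]]]].
    exists p1, (bump_deriv q2 p2 k2), k1, k2.+2; apply/funext => x.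
    by have [] := is_derive_tensor2 (bump_fun q1 p1 k1) (is_derive_bump q2 p2 k2 x.2).
  exists (bump_deriv q1 p1 k1), p2, k1.+2, k2; apply/funext => x.
  by have [] := is_derive_tensor1 (bump_fun q2 p2 k2) (is_derive_bump q1 p1 k1 x.1).
Qed.

(** For a < b it is positive exactly on ]a, b + 1/(n+1)[, and on ]a, b] it is at least (n+1)(t - a).
    Hence exp(-1/window) tends to the indicator of the half-open interval; the square of n+1
    outweighs the factor 1/(n+1) that remains at t = b. *)
Definition window (a b : R) (n : nat) : {poly R} :=
  (n.+1%:R ^+ 2)%:P * ('X - a%:P) * ((b + n.+1%:R^-1)%:P - 'X).

Lemma windowE a b n t :
  (window a b n).[t] = n.+1%:R ^+ 2 * (t - a) * (b + n.+1%:R^-1 - t).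
Proof. by rewrite /window !hornerE. Qed.

Lemma window_gt0 a b n t : a < b -> 0 < (window a b n).[t] -> a < t < b + n.+1%:R^-1.
Proof.
move=> ab; rewrite windowE -mulrA pmulr_rgt0 ?exprn_gt0// => h.
have n0 : 0 < n.+1%:R^-1 :> R by rewrite invr_gt0.
move: (n.+1%:R^-1) n0 h => d d0 h.
have [ta|ta] := leP t a.
  have : (t - a) * (b + d - t) <= 0 by rewrite mulr_le0_ge0; lra.
  by rewrite leNgt h.
rewrite /=; have [//|tb] := ltP t (b + d).
have : (t - a) * (b + d - t) <= 0 by rewrite mulr_ge0_le0; lra.
by rewrite leNgt h.
Qed.

Lemma cvg_flat_window a b t : a < b ->
  flat 0 (window a b n).[t] @[n --> \oo] --> (\1_(`]a, b]%classic) t : R).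
Proof.
move=> ab.
have [ta|ta] := leP t a.
  rewrite indicE memNset; last by rewrite /= in_itv/= ltNge ta.
  rewrite (_ : (fun n => _) = cst 0); first exact: cvg_cst.
  apply/funext => n; rewrite /flat; case: ifPn => // /(window_gt0 ab).
  by rewrite ltNge ta.
have [tb|bt] := leP t b; last first.
  rewrite indicE memNset; last by rewrite /= in_itv/= ta leNgt bt.
  apply: (cvg_near_cst 0); rewrite -(subr_gt0) in bt.
  have [N _ Nt] := @near_infty_natSinv_lt R (PosNum bt).
  exists N => // n /= Nn; rewrite /flat; case: ifPn => // /(window_gt0 ab) /andP[_].
  have /= := Nt n Nn; move: (n.+1%:R^-1) => d h1 h2; exfalso; lra.
rewrite indicE mem_set; last by rewrite /= in_itv/= ta.
pose c := (t - a)^-1; have c0 : 0 < c by rewrite invr_gt0 subr_gt0.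
have n0 n : 0 < n.+1%:R :> R by [].
have lo n : n.+1%:R * (t - a) <= (window a b n).[t].
  have -> : (window a b n).[t] = n.+1%:R * (t - a) * (n.+1%:R * (b - t) + 1).
    rewrite windowE; have : n.+1%:R != 0 :> R by [].
    by move: (n.+1%:R) => m m0; field.
  by rewrite ler_peMr ?mulr_ge0 ?subr_ge0 ?(ltW ta)// lerDr mulr_ge0// subr_ge0.
(* The lower bound comes from exp(-1/w) >= 1 - 1/w, where w is the window value, together with 1/w
   <= c/(n+1). *)
apply: (@squeeze_cvgr _ _ _ _ (fun n => 1 - c * n.+1%:R^-1) (cst 1)); last exact: cvg_cst.
- apply: nearW => n; rewrite flat0_le1 andbT /flat.
  have w0 : 0 < (window a b n).[t].
    by apply: lt_le_trans (lo n); rewrite mulr_gt0// subr_gt0.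
  rewrite w0 expr0 mul1r; apply: le_trans (expR_ge1Dx _).
  rewrite lerD2l lerN2 -invfM lef_pV2 ?posrE//; first by rewrite mulrC.
  by rewrite mulr_gt0// subr_gt0.
- rewrite -[X in _ --> X]subr0 -(mulr0 c); apply: cvgB; first exact: cvg_cst.
  by apply: cvgM; [exact: cvg_cst|exact: cvg_harmonic].
Qed.

Definition bump a b c d n : R * R -> R :=
  tensor_bump (window a b n) (window c d n) 1 1 0 0.

Lemma bumpE a b c d n z :
  bump a b c d n z = flat 0 (window a b n).[z.1] * flat 0 (window c d n).[z.2].
Proof. by rewrite /bump /tensor_bump /bump_fun -polyC1 !hornerC !mul1r. Qed.

(** The box is the same for all [n]: it yields the compact support and, later, a common dominating
    function. *)
Lemma bump_outside a b c d n z : a < b -> c < d ->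
  ~ (`]a, b + 1] `*` `]c, d + 1])%classic z -> bump a b c d n z = 0.
Proof.
move=> ab cd; apply: contra_notP => /eqP; rewrite bumpE mulf_eq0 negb_or => /andP[z1 z2].
have flat_neq0 u : flat 0 u != 0 -> 0 < u :> R by rewrite /flat; case: ifPn; rewrite ?eqxx.
have /andP[az zb] := window_gt0 ab (flat_neq0 _ z1).
have /andP[cz zd] := window_gt0 cd (flat_neq0 _ z2).
have n1 : n.+1%:R^-1 <= 1 :> R by rewrite invf_le1// ler1n.
split; rewrite /= in_itv/= ?az ?cz/=.
  by rewrite (le_trans (ltW zb))// lerD2l.
by rewrite (le_trans (ltW zd))// lerD2l.
Qed.

Lemma bump_test a b c d n : a < b -> c < d -> test_function (bump a b c d n).
Proof.
move=> ab cd; split; first exact: tensor_bump_smooth.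
have cK : compact (`[a, b + 1] `*` `[c, d + 1] : set (R * R)).
  by apply: compact_setX; exact: segment_compact.
apply: (subclosed_compact _ cK); first exact: closed_closure.
have clK : closed (`[a, b + 1] `*` `[c, d + 1] : set (R * R)).
  exact: compact_closed (@norm_hausdorff _ _) cK.
rewrite [X in _ `<=` X](closure_id _).1//.
apply: closure_subset => z /= z0; apply: contrapT => zK.
move/eqP: z0; apply; apply: bump_outside => //; apply: contra_not zK => -[z1 z2].
by split; apply: subset_itv_oc_cc.
Qed.

Lemma bump_bound a b c d n z : `|bump a b c d n z| <= 1.
Proof.
by rewrite bumpE normrM !ger0_norm ?flat0_ge0// mulr_ile1 ?flat0_ge0 ?flat0_le1.
Qed.

Lemma cvg_bump a b c d z : a < b -> c < d ->
  bump a b c d n z @[n --> \oo] --> (\1_(`]a, b] `*` `]c, d])%classic z : R).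
Proof.
move=> ab cd.
have -> : \1_(`]a, b] `*` `]c, d])%classic z = \1_(`]a, b]%classic) z.1 * \1_(`]c, d]%classic) z.2 :> R.
  by rewrite !indicE in_setX -natrM mulnb.
under eq_fun do rewrite bumpE.
by apply: cvgM; exact: cvg_flat_window.
Qed.

End bump_plane.

(** * Orthogonality to test functions forces vanishing almost everywhere *)

Section fundamental_lemma.
Context {R : realType}.
Local Notation mu := (@lebesgue_measure R).

Definition rectangles : set (set (plane R)) :=
  [set A `*` B | A in @ocitv R & B in @ocitv R].

Lemma rectanglesI : setI_closed rectangles.
Proof.
move=> _ _ [A1 oA1 [B1 oB1 <-]] [A2 oA2 [B2 oB2 <-]]; rewrite -setXI.
by exists (A1 `&` A2); [exact: ocitvI|exists (B1 `&` B2) => //; exact: ocitvI].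
Qed.

Lemma measurable_ocitv (A : set (measurableTypeR R)) : ocitv A -> measurable A.
Proof. by move=> oA; apply: sub_sigma_algebra. Qed.

(** Half-open rectangles are stable under intersection, as the Dynkin argument demands. A strip is
    the countable union of its rectangles cut by ]-n, n], so both projections are measurable for the
    generated sigma-algebra, and so are all measurable products. *)
Lemma plane_measurableE : @measurable _ (plane R) = <<s rectangles >>.
Proof.
rewrite measurable_prod_measurableType; apply/seteqP; split; last first.
  apply: sub_sigma_algebra2 => _ [A oA [B oB <-]].
  by exists A; [exact: measurable_ocitv|exists B => //; exact: measurable_ocitv].
apply: smallest_sub; first exact: smallest_sigma_algebra.
pose T := g_sigma_algebraType rectangles.
have RT : \bigcup_(n : nat) `](- n%:R : R), n%:R]%classic = setT.
  apply/seteqP; split => // x _; exists (Num.bound `|x|).+1 => //.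
  have := archi_boundP (normr_ge0 x); set N := Num.bound _ => xN.
  move: xN; rewrite ltr_norml /= in_itv/= => /andP[x1 x2].
  apply/andP; split; last by rewrite (le_trans (ltW x2))// ler_nat.
  by apply: le_lt_trans x1; rewrite lerN2 ler_nat.
have mfst : measurable_fun setT (fst : T -> measurableTypeR R).
  apply: (measurability (@ocitv R)) => // _ [A oA <-].
  rewrite setTI.
  have -> : (fst : T -> measurableTypeR R) @^-1` A = \bigcup_(n : nat) (A `*` `](- n%:R : R), n%:R]%classic).
    by rewrite -setX_bigcupr RT; apply/seteqP; split => z; [split|case].
  apply: bigcupT_measurable => n; apply: sub_sigma_algebra.
  by exists A => //; exists `](- n%:R : R), n%:R]%classic => //; exact: is_ocitv.
have msnd : measurable_fun setT (snd : T -> measurableTypeR R).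
  apply: (measurability (@ocitv R)) => // _ [A oA <-].
  rewrite setTI.
  have -> : (snd : T -> measurableTypeR R) @^-1` A = \bigcup_(n : nat) (`](- n%:R : R), n%:R]%classic `*` A).
    by rewrite -setX_bigcupl RT; apply/seteqP; split => z; [split|case].
  apply: bigcupT_measurable => n; apply: sub_sigma_algebra.
  by exists `](- n%:R : R), n%:R]%classic; [exact: is_ocitv|exists A].
move=> _ [A mA [B mB <-]].
have -> : A `*` B = (fst : T -> measurableTypeR R) @^-1` A `&` (snd : T -> measurableTypeR R) @^-1` B by [].
have h1 := mfst measurableT _ mA; have h2 := msnd measurableT _ mB.
by rewrite !setTI in h1 h2; exact: (measurableI _ _ h1 h2).
Qed.

Variable g : plane R -> R.
Hypothesis mg : measurable_fun setT g.
Hypothesis ig : forall E : set (plane R), measurable E -> (leb2 R E < +oo)%E ->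
  (leb2 R).-integrable E (EFin \o g).
Hypothesis g_test : forall phi, test_function phi -> \int[leb2 R]_x (g x * phi x) = 0.

Lemma rectangles_measurable E : rectangles E -> @measurable _ (plane R) E.
Proof.
by move=> [A oA [B oB <-]]; apply: measurableX; exact: measurable_ocitv.
Qed.

Lemma leb2_rectangles_lty E : rectangles E -> (leb2 R E < +oo)%E.
Proof.
move=> [_ [[a b] _ <-] [_ [[c d] _ <-] <-]].
rewrite leb2_setX ?lebesgue_measure_itv/=; [|exact: measurable_itv..].
by do 2 case: ifPn => _; rewrite ?mule0 ?mul0e ?ltry// -!EFinD -EFinM ltry.
Qed.

(** The bumps converge pointwise to the indicator of the half-open rectangle, and their products
    with [g] are dominated by |g| on the fixed larger box [K]. *)
Lemma integral_rectangle_eq0 E : rectangles E -> (\int[leb2 R]_(x in E) (g x)%:E = 0)%E.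
Proof.
move=> [_ [[a b] _ <-] [_ [[c d] _ <-] <-]] /=.
have [ab|ba] := ltP a b; last first.
  by rewrite [X in X `*` _]set_itv_ge ?bnd_simp -?leNgt// set0X integral_set0.
have [cd|dc] := ltP c d; last first.
  by rewrite [X in _ `*` X]set_itv_ge ?bnd_simp -?leNgt// setX0 integral_set0.
pose K : set (plane R) := `]a, b + 1]%classic `*` `]c, d + 1]%classic.
have oK : rectangles K by exists `]a, b + 1]%classic; [exact: is_ocitv|exists `]c, d + 1]%classic => //; exact: is_ocitv].
have mK := rectangles_measurable oK.
set Q : set (plane R) := _ `*` _.
have mQ : measurable Q by apply: measurableX; exact: measurable_itv.
have iK : (leb2 R).-integrable setT (fun x => `|((EFin \o g) \_ K) x|%E).
  apply: integrable_abse; apply: (iffLR (integrable_mkcond _ mK)).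
  by apply: ig => //; exact: leb2_rectangles_lty.
have mb n : measurable_fun setT (bump a b c d n : plane R -> R).
  by apply: C1c_measurable; apply: test_function_C1c; exact: bump_test.
have gK x n : (`|(g x * bump a b c d n x)%:E| <= `|((EFin \o g) \_ K) x|)%E.
  rewrite /patch; case: ifPn => [_|].
    by rewrite /= lee_fin normrM ler_piMr// bump_bound.
  by rewrite notin_setE => xK; rewrite bump_outside ?mulr0 ?normr0//.
have [] := @dominated_convergence _ _ _ (leb2 R) setT measurableT
  (fun n x => (g x * bump a b c d n x)%:E) (fun x => (g x * \1_Q x)%:E)
  (fun x => `|((EFin \o g) \_ K) x|%E).
- by move=> n; apply/measurable_EFinP; exact: measurable_funM.
- by apply/measurable_EFinP; apply: measurable_funM => //; exact: measurable_indic.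
- apply: aeW => x _; apply: cvg_EFin; first exact: nearW.
  by apply: cvgM; [exact: cvg_cst|exact: cvg_bump].
- exact: iK.
- by apply: aeW => x n _; exact: gK.
move=> _ _ cv.
have -> : (\int[leb2 R]_(x in Q) (g x)%:E = \int[leb2 R]_x (g x * \1_Q x)%:E)%E.
  rewrite integral_mkcond; apply: eq_integral => x _; rewrite /patch indicE.
  by case: ifPn; rewrite ?mulr1 ?mulr0.
rewrite -(cvg_lim _ cv)//; apply: lim_near_cst => //; apply: nearW => n.
have := g_test (bump_test n ab cd); rewrite /Rintegral => h.
rewrite -[LHS]fineK ?h//; apply: integrable_fin_num => //.
apply: le_integrable iK => //.
  by apply/measurable_EFinP; exact: measurable_funM.
by move=> x _; rewrite [leRHS]abse_id.
Qed.

(** The Dynkin argument runs inside a fixed rectangle [B]: [g] is only locally integrable, and the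
    cut makes its integral additive over countable disjoint unions. *)
Lemma integral_measurable_eq0 (E B : set (plane R)) : measurable E -> rectangles B ->
  (\int[leb2 R]_(x in E `&` B) (g x)%:E = 0)%E.
Proof.
move=> mE rB; have mB := rectangles_measurable rB.
have iB := ig mB (leb2_rectangles_lty rB).
pose P (A : set (plane R)) := (\int[leb2 R]_(x in A `&` B) (g x)%:E = 0)%E.
suff h : forall A : set (plane R), <<s rectangles >> A -> P A.
  by apply: h; rewrite -plane_measurableE.
apply: (@dynkin_induction _ (plane R) rectangles P plane_measurableE rectanglesI).
- by rewrite /P setTI; exact: integral_rectangle_eq0.
- by move=> A rA; rewrite /P; apply: integral_rectangle_eq0; exact: rectanglesI.
- move=> A mA; rewrite /P => A0.
  have : (\int[leb2 R]_(x in (A `&` B) `|` (~` A `&` B)) (g x)%:E = 0)%E.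
    by rewrite -setIUl setUv setTI integral_rectangle_eq0.
  rewrite integral_setU ?A0 ?add0e//.
  + exact: measurableI.
  + by apply: measurableI => //; exact: measurableC.
  + by apply: measurable_funTS; exact/measurable_EFinP.
  + by apply/disj_setPS => x [[Ax _] [nAx _]].
- move=> F mF tF F0; rewrite /P setI_bigcupl integral_bigcup.
  + by rewrite eseries0// => n _ _; exact: F0.
  + by move=> i j _ _ [x [[Fi _] [Fj _]]]; apply: (tF i j) => //; exists x.
  + by move=> k; exact: measurableI.
  + apply: integrableS iB => //; last by move=> x [k _ []].
    by apply: bigcupT_measurable => k; exact: measurableI.
Qed.

Lemma test_function_ae_eq0 : {ae leb2 R, forall x, g x = 0}.
Proof.
pose I n : set R := `](- n%:R), n%:R]%classic.
pose B n : set (plane R) := I n `*` I n.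
have rB n : rectangles (B n).
  by exists (I n); [exact: is_ocitv|exists (I n) => //; exact: is_ocitv].
have aeB n : {ae leb2 R, forall x, B n x -> (g x)%:E = 0%E}.
  have mB := rectangles_measurable (rB n).
  apply: (@integral_ae_eq _ _ _ (leb2 R) (B n) mB (cst 0%E) (EFin \o g)) => //.
    by apply: ig => //; exact: leb2_rectangles_lty.
  move=> E EB mE; rewrite integral0 -[E](setIidl EB).
  exact: integral_measurable_eq0.
have := ae_foralln aeB; apply: filterS => -[x y] /= h.
have := archi_boundP (normr_ge0 x); set n1 := Num.bound _ => xn.
have := archi_boundP (normr_ge0 y); set n2 := Num.bound _ => yn.
have n1n2 (z : R) n m : `|z| < n%:R -> (n <= m)%N -> I m z.
  move=> zn nm; have : `|z| < m%:R by rewrite (lt_le_trans zn)// ler_nat.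
  by rewrite ltr_norml /I /= in_itv/= => /andP[-> /ltW].
apply: EFin_inj; apply: (h (maxn n1 n2)).
by split; [apply: n1n2 xn _|apply: n1n2 yn _]; rewrite ?leq_maxl ?leq_maxr.
Qed.

End fundamental_lemma.

(** * Square integrable functions, bounded fields and distributional divergence *)

Section square_integrable.
Context {R : realType}.
Implicit Types f g h : plane R -> R.

(** Membership in L^2 (see [LfunP]) freed from absolute values and real powers, so that squares of
    sums expand by ring identities. *)
Definition sqint g := measurable_fun setT g /\
  (leb2 R).-integrable setT (fun x => (g x ^+ 2)%:E).

Lemma L2norm_sqr g : (L2norm g ^+ 2 = \int[leb2 R]_x (g x ^+ 2)%:E)%E.
Proof.
rewrite /L2norm unlock poweR12_sqrt ?sqr_sqrte.
- apply: eq_integral => x _ /=.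
  by rewrite -[2%R]/(2%:R) powR_mulrn ?normr_ge0// real_normK ?num_real.
- by apply: integral_ge0 => x _; exact: poweR_ge0.
- by apply: integral_ge0 => x _; exact: poweR_ge0.
Qed.

Lemma LfunP g : reflect (sqint g) (g \in Lfun (leb2 R) 2%:E).
Proof.
apply: (iffP idP) => [gL|[mg ig]].
  split; first by move: gL; rewrite inE => /andP[+ _]; rewrite inE.
  exact: Lfun2_integrable_sqr.
rewrite inE; apply/andP; split; rewrite inE//= /finite_norm.
have : (L2norm g ^+ 2 < +oo)%E by rewrite L2norm_sqr; exact: integrable_lty.
rewrite /L2norm; case: (Lnorm _ _ _) (Lnorm_ge0 (leb2 R) 2%:E (EFin \o g)) => [r|_|//].
  by move=> _ _; exact: ltry.
by rewrite expe2.
Qed.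

Definition sqnorm g : R := \int[leb2 R]_x (g x ^+ 2).

Lemma sqnormE g : sqint g -> (L2norm g ^+ 2 = (sqnorm g)%:E)%E.
Proof. by move=> [mg ig]; rewrite L2norm_sqr /sqnorm /Rintegral fineK// integrable_fin_num. Qed.

Lemma sqnorm_ge0 g : 0 <= sqnorm g.
Proof. by apply: Rintegral_ge0 => x _; exact: sqr_ge0. Qed.

Lemma sqint_mul_integrable f g : sqint f -> sqint g ->
  (leb2 R).-integrable setT (fun x => (f x * g x)%:E).
Proof.
by move=> /LfunP fL /LfunP gL; exact: (Lfun1_integrable _ _).1 (Lfun2_mul_Lfun1 fL gL).
Qed.

Lemma sqintD (c : R) f g : sqint f -> sqint g -> sqint (fun x => f x + c * g x).
Proof.
move=> sf sg; have [mf if2] := sf; have [mg ig2] := sg; split.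
  by apply: measurable_funD => //; exact: measurable_funM.
have E : (fun x => ((f x + c * g x) ^+ 2)%:E) =
  (fun x => (f x ^+ 2)%:E + (2 * c)%:E * (f x * g x)%:E + (c ^+ 2)%:E * (g x ^+ 2)%:E)%E.
  by apply/funext => x; rewrite -!EFinM -!EFinD; congr EFin; ring.
rewrite E; apply: integrableD => //; last exact: integrableZl.
by apply: integrableD => //; apply: integrableZl => //; exact: sqint_mul_integrable.
Qed.

Lemma sqnormD (c : R) f g : sqint f -> sqint g ->
  sqnorm (fun x => f x + c * g x) = sqnorm f + 2 * c * (\int[leb2 R]_x (f x * g x)) + c ^+ 2 * sqnorm g.
Proof.
move=> sf sg; have [mf if2] := sf; have [mg ig2] := sg.
have ifg := sqint_mul_integrable sf sg.
have iB : (leb2 R).-integrable setT (fun x => (2 * c * (f x * g x))%:E).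
  exact: (integrableZl measurableT (2 * c) ifg).
have iC : (leb2 R).-integrable setT (fun x => (c ^+ 2 * (g x ^+ 2))%:E).
  exact: (integrableZl measurableT (c ^+ 2) ig2).
have iD : (leb2 R).-integrable setT (fun x => (f x ^+ 2 + 2 * c * (f x * g x))%:E).
  exact: (integrableD measurableT if2 iB).
rewrite /sqnorm -(RintegralZl (2 * c) measurableT ifg) -(RintegralZl (c ^+ 2) measurableT ig2).
rewrite -(RintegralD measurableT if2 iB) -(RintegralD measurableT iD iC).
by apply: eq_Rintegral => x _; ring.
Qed.

Lemma sqint0 : sqint (fun=> 0).
Proof.
by split => //; under eq_fun do rewrite expr0n; exact: integrable0.
Qed.

Lemma sqintB f g : sqint f -> sqint g -> sqint (fun x => f x - g x).
Proof.
move=> sf sg; have := sqintD (-1) sf sg; congr sqint.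
by apply/funext => x; rewrite mulN1r.
Qed.

(** On a set of finite measure the integrable function 1 + g^2 dominates |g|. *)
Lemma sqint_locally_integrable g (E : set (plane R)) : sqint g -> measurable E ->
  (leb2 R E < +oo)%E -> (leb2 R).-integrable E (EFin \o g).
Proof.
move=> [mg ig] mE Eoo.
have i1 : (leb2 R).-integrable E (EFin \o cst 1).
  by apply: measurable_bounded_integrable => //; exists 1; split; [exact: num_real|move=> y y1 x _ /=; rewrite normr1 ltW].
have i2 : (leb2 R).-integrable E (fun x => (g x ^+ 2)%:E) by exact: integrableS ig.
apply: le_integrable (integrableD mE i1 i2) => //.
  by apply/measurable_EFinP; exact: measurable_funTS.
move=> x _ /=; rewrite lee_fin [leRHS]ger0_norm ?addr_ge0 ?sqr_ge0//.
rewrite -[g x ^+ 2]real_normK ?num_real//; have := sqr_ge0 (`|g x| - 1).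
by have := normr_ge0 (g x); move: (`|g x|) => a; nra.
Qed.

(** Chebyshev's inequality for g^2 at level t^2. It supplies the finite level sets required by the
    weak bound. *)
Lemma sqint_level g (t : R) : sqint g -> 0 < t -> (leb2 R [set x | (t < `|g x|)%R] < +oo)%E.
Proof.
move=> [mg ig] t0.
have mg2 : measurable_fun setT (fun x => (g x ^+ 2)%:E).
  by apply/measurable_EFinP; exact: measurable_funX.
have := @le_integral_abse _ _ _ (leb2 R) setT measurableT _ (t ^+ 2) mg2 (exprn_gt0 2 t0).
have /integrableP[_ i2] := ig; move=> /le_lt_trans/(_ i2).
rewrite setTI; set S := [set x | _] => Soo.
apply: (@le_lt_trans _ _ (leb2 R S)).
  apply: le_measure; rewrite ?inE.
  - rewrite -[X in measurable X]setTI.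
    have mg' : measurable_fun setT (fun x : plane R => `|g x|) by exact: measurableT_comp.
    rewrite (_ : [set x | _] = (fun x : plane R => `|g x|) @^-1` `]t, +oo[).
      by apply: mg' => //; exact: measurable_itv.
    by apply/seteqP; split => y /=; rewrite in_itv/= andbT.
  - rewrite -[S]setTI; have -> : S = (fun x => `|(g x ^+ 2)%:E|%E) @^-1` `[(t ^+ 2)%:E, +oo[.
      by apply/seteqP; split => y /=; rewrite in_itv/= andbT.
    by apply: (measurableT_comp _ mg2) => //; exact: emeasurable_itv.
  - move=> x /= tx; rewrite /S /= lee_fin normrX ler_pXn2r// ?nnegrE ?ltW//.
have t2 : 0 < t ^+ 2 by rewrite exprn_gt0.
move: Soo; case: (leb2 R S) (measure_ge0 (leb2 R) S) => [r _ _|_|//]; first exact: ltry.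
by rewrite gt0_muley ?lte_fin.
Qed.

Lemma C1c_sqint f : C1c f -> sqint f.
Proof.
move=> Cf; split; first exact: C1c_measurable.
exact: C1c_integrable (C1cM Cf Cf).
Qed.

Lemma C1c_partial_sqint f i : C1c f -> sqint (partial i f).
Proof.
move=> Cf; have mf := C1c_partial_measurable i Cf; split => //.
have [N [M [_ _ fN _ fM]]] := C1c_partial_bound Cf.
apply: (@box_supported_integrable _ (fun x => partial i f x ^+ 2) N (M ^+ 2)).
- exact: measurable_funX.
- by move=> x; rewrite normrX ler_pXn2r// nnegrE// (le_trans _ (fM i x)).
- by move=> x xN; rewrite fN// expr0n.
Qed.

End square_integrable.

Section bounded_fields.
Context {R : realType}.
Implicit Types (u v w : R * R -> R * R) (g h phi : R * R -> R).

(** The norm at exponent [+oo] is the essential supremum in the branch where the total measure is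
    positive. *)
Lemma leb2_setT_gt0 : (0 < leb2 R setT)%E.
Proof.
apply: (@lt_le_trans _ _ (leb2 R ([set y | `|y.1| <= 1] `&` [set y | `|y.2| <= 1]))).
  by rewrite leb2_square// lte_fin exprn_gt0// mulr_gt0.
by apply: le_measure; rewrite ?inE//; exact: measurable_square.
Qed.

Lemma ae_imp (P P' : plane R -> Prop) : (forall x, P x -> P' x) ->
  {ae leb2 R, forall x, P x} -> {ae leb2 R, forall x, P' x}.
Proof. by move=> PP'; apply: (@filterS _ _ (ae_filter_ringOfSetsType (leb2 R))). Qed.

Lemma ae_imp2 (P1 P2 P' : plane R -> Prop) : (forall x, P1 x -> P2 x -> P' x) ->
  {ae leb2 R, forall x, P1 x} -> {ae leb2 R, forall x, P2 x} ->
  {ae leb2 R, forall x, P' x}.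
Proof. by move=> PP'; apply: (@filterS2 _ _ (ae_filter_ringOfSetsType (leb2 R))). Qed.

Lemma supnorm_leP u (M : R) :
  (supnorm u <= M%:E)%E <-> {ae leb2 R, forall x, enorm (u x) <= M}.
Proof.
rewrite /supnorm unlock leb2_setT_gt0; split => [/ess_supP|h].
  by apply: ae_imp => x; rewrite /= lee_fin ger0_norm ?enorm_ge0.
apply/ess_supP.
suff : {ae leb2 R, forall x, (`|(enorm (u x))%:E| <= M%:E)%E} by [].
by move: h; apply: ae_imp => x; rewrite /= lee_fin ger0_norm ?enorm_ge0.
Qed.

Lemma supnorm_ge0 u : (0 <= supnorm u)%E.
Proof. exact: Lnorm_ge0. Qed.

Lemma supnorm_fin u : Linfty_field u -> exists2 s : R, 0 <= s & supnorm u = s%:E.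
Proof.
move=> [_ uoo]; exists (fine (supnorm u)); first by rewrite fine_ge0// supnorm_ge0.
by rewrite fineK// ge0_fin_numE// supnorm_ge0.
Qed.

(** Nonnegative combinations cover every field to come: u1 + e w, (1 - e) u1 and u1 + u2. *)
Lemma supnorm_combine u v (a c S T : R) : 0 <= a -> 0 <= c ->
  (supnorm u <= S%:E)%E -> (supnorm v <= T%:E)%E ->
  (supnorm (fun x => a *: u x + c *: v x)%R <= (a * S + c * T)%R%:E)%E.
Proof.
move=> a0 c0 /supnorm_leP uS /supnorm_leP vT; apply/supnorm_leP.
move: uS vT; apply: ae_imp2 => x uS vT; apply: le_trans (ler_enormD _ _) _.
by rewrite !enormZ !ger0_norm// lerD// ler_wpM2l.
Qed.

Lemma measurable_combine u v (a c : R) :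
  measurable_fun setT (u : plane R -> plane R) -> measurable_fun setT (v : plane R -> plane R) ->
  measurable_fun setT ((fun x => a *: u x + c *: v x) : plane R -> plane R).
Proof.
move=> /measurable_fun_pairP[u1 u2] /measurable_fun_pairP[v1 v2].
apply: measurable_fun_pair; apply: (@measurable_funD _ (plane R) R);
  by apply: (@measurable_funM _ (plane R) R).
Qed.

Lemma Linfty_combine u v (a c : R) : 0 <= a -> 0 <= c ->
  Linfty_field u -> Linfty_field v -> Linfty_field (fun x => a *: u x + c *: v x).
Proof.
move=> a0 c0 Lu Lv; have [S S0 uS] := supnorm_fin Lu; have [T T0 vT] := supnorm_fin Lv.
split; first exact: measurable_combine Lu.1 Lv.1.
apply: le_lt_trans (supnorm_combine a0 c0 (S := S) (T := T) _ _) _; rewrite ?uS ?vT//.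
exact: ltry.
Qed.

Definition pairing u phi (x : plane R) : R :=
  (u x).1 * partial false phi x + (u x).2 * partial true phi x.

Lemma pairing_integrable u phi : Linfty_field u -> C1c phi ->
  (leb2 R).-integrable setT (EFin \o pairing u phi).
Proof.
move=> Lu Cp; have [S S0 uS] := supnorm_fin Lu.
have /supnorm_leP aS : (supnorm u <= S%:E)%E by rewrite uS.
have [/measurable_fun_pairP[u1 u2] _] := Lu.
have i1 := integrableZl measurableT S (integrable_abse (C1c_partial_integrable false Cp)).
have i2 := integrableZl measurableT S (integrable_abse (C1c_partial_integrable true Cp)).
have mp : measurable_fun setT (EFin \o pairing u phi).
  apply/measurable_EFinP; apply: measurable_funD; apply: measurable_funM => //;
  exact: C1c_partial_measurable.
have /integrableP[mi fi] := integrableD measurableT i1 i2.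
apply/integrableP; split => //; apply: le_lt_trans fi.
apply: ae_ge0_le_integral => //.
- exact: measurableT_comp.
- exact: measurableT_comp.
move: aS; apply: ae_imp => x ux _ /=; rewrite lee_fin.
have b1 : `|(u x).1 * partial false phi x| <= S * `|partial false phi x|.
  by rewrite normrM ler_wpM2r// (le_trans (ler_enorm1 _)).
have b2 : `|(u x).2 * partial true phi x| <= S * `|partial true phi x|.
  by rewrite normrM ler_wpM2r// (le_trans (ler_enorm2 _)).
apply: le_trans (ler_normD _ _) _; apply: le_trans (lerD b1 b2) _.
by rewrite ler_norm.
Qed.

Lemma is_div_combine u v g h (a c : R) : Linfty_field u -> Linfty_field v ->
  sqint g -> sqint h -> is_div u g -> is_div v h ->
  is_div (fun x => a *: u x + c *: v x) (fun x => a * g x + c * h x).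
Proof.
move=> Lu Lv sg sh ug vh phi tphi; have Cp := test_function_C1c tphi.
have iu := pairing_integrable Lu Cp; have iv := pairing_integrable Lv Cp.
have ig := sqint_mul_integrable sg (C1c_sqint Cp).
have ih := sqint_mul_integrable sh (C1c_sqint Cp).
transitivity (\int[leb2 R]_x (a * pairing u phi x + c * pairing v phi x)).
  apply: eq_Rintegral => x _; rewrite /pairing.
  have -> : (a *: u x + c *: v x).1 = a * (u x).1 + c * (v x).1 by [].
  have -> : (a *: u x + c *: v x).2 = a * (u x).2 + c * (v x).2 by [].
  by move: (u x).1 (u x).2 (v x).1 (v x).2 (partial _ _ _) (partial _ _ _) => *; ring.
rewrite (RintegralD measurableT (integrableZl measurableT a iu) (integrableZl measurableT c iv)).
rewrite (RintegralZl a measurableT iu) (RintegralZl c measurableT iv).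
rewrite [\int[_]_x pairing u phi x]ug// [\int[_]_x pairing v phi x]vh//.
rewrite mulrN mulrN -opprD -(RintegralZl a measurableT ig) -(RintegralZl c measurableT ih).
rewrite -(RintegralD measurableT (integrableZl measurableT a ig) (integrableZl measurableT c ih)).
by congr (- _); apply: eq_Rintegral => x _; ring.
Qed.

Lemma is_div0 : is_div (fun=> 0) (fun=> 0 : R).
Proof.
move=> phi _; transitivity (\int[leb2 R]_x (0 : R)).
  by apply: eq_Rintegral => x _; rewrite !mul0r addr0.
by under [in RHS]eq_Rintegral do rewrite mul0r; rewrite Rintegral_cst// mul0r oppr0.
Qed.

Lemma is_div_unique u g h : sqint g -> sqint h -> is_div u g -> is_div u h ->
  {ae leb2 R, forall x, g x = h x}.
Proof.
move=> sg sh ug uh; have sd := sqintB sg sh.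
have : {ae leb2 R, forall x, g x - h x = 0}.
  apply: (@test_function_ae_eq0 R (fun x => g x - h x)); first exact: sd.1.
    by move=> E mE Eoo; exact: sqint_locally_integrable.
  move=> phi tphi; have Cp := test_function_C1c tphi.
  have ig := sqint_mul_integrable sg (C1c_sqint Cp).
  have ih := sqint_mul_integrable sh (C1c_sqint Cp).
  under eq_Rintegral do rewrite mulrBl.
  rewrite (RintegralB measurableT ig ih).
  by apply/eqP; rewrite subr_eq0 -eqr_opp -ug// -uh.
by apply: ae_imp => x /eqP; rewrite subr_eq0 => /eqP.
Qed.

(** The witness [h] shows that [xget] chooses inside [L2_divs u], and uniqueness identifies its
    choice with [h] almost everywhere. *)
Lemma divL2P u h : sqint h -> is_div u h ->
  [/\ sqint (divL2 u), is_div u (divL2 u) & {ae leb2 R, forall x, divL2 u x = h x}].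
Proof.
move=> sh uh; have Hh : L2_divs u h by split => //; apply/LfunP.
have [/LfunP sd ud] : L2_divs u (divL2 u) by exact: (xgetPex _ (ex_intro _ h Hh)).
by split => //; exact: is_div_unique ud uh.
Qed.

Lemma sqnorm_ae g h : sqint g -> sqint h -> {ae leb2 R, forall x, g x = h x} -> sqnorm g = sqnorm h.
Proof.
move=> [mg _] [mh _] gh; congr fine; apply: ae_eq_integral => //.
- by apply/measurable_EFinP; exact: measurable_funX.
- by apply/measurable_EFinP; exact: measurable_funX.
- by move: gh; apply: ae_imp => x -> _.
Qed.

(** This frees the energy from the representative chosen by [divL2]: any square integrable
    divergence computes it. *)
Lemma energyE (lambda s : R) f u h : sqint f -> sqint h -> is_div u h -> supnorm u = s%:E ->
  energy lambda f u = (s + lambda * sqnorm (fun x => f x - h x))%:E.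
Proof.
move=> sf sh uh us; rewrite /energy; case: asboolP => [_|]; last first.
  by case; exists h; split => //; apply/LfunP.
have [sd _ dh] := divL2P sh uh.
rewrite us (sqnormE (sqintB sf sd)) (sqnorm_ae (sqintB sf sd) (sqintB sf sh)) ?EFinD ?EFinM//.
by move: dh; apply: ae_imp => x ->.
Qed.

End bounded_fields.

(** * The minimizer *)

Section minimizer.
Context {R : realType}.
Variables (f : R * R -> R) (u1 : R * R -> R * R).
Hypothesis sf : sqint f.
Hypothesis f_neq0 : ~ {ae leb2 R, forall x, f x = 0}.
Let nf : R := fine (L2norm f).
Hypothesis u1_min : energy_minimizer nf^-1 f u1.

Lemma L2norm_fineK : L2norm f = nf%:E.
Proof.
rewrite /nf fineK// ge0_fin_numE ?Lnorm_ge0//.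
by have /LfunP := sf; rewrite inE => /andP[_]; rewrite inE.
Qed.

Lemma sqr_nf : nf ^+ 2 = sqnorm f.
Proof. by apply: EFin_inj; rewrite -(sqnormE sf) L2norm_fineK EFin_expe. Qed.

Lemma nf_gt0 : 0 < nf.
Proof.
rewrite lt_def fine_ge0 ?Lnorm_ge0// andbT; apply: contra_notN f_neq0 => /eqP nf0.
have := @Lnorm_eq0_eq0 _ _ _ (leb2 R) (EFin \o f) 2%:E.
case=> //; first by apply/measurable_EFinP; exact: sf.1.
- by have := L2norm_fineK; rewrite nf0.
- by move=> A [mA A0 fA]; exists A; split => // x /= fx; apply: fA => /= /(_ I) [].
Qed.

Let Linfty0 : Linfty_field (fun=> 0 : R * R).
Proof.
split; first exact: measurable_cst.
apply: (@le_lt_trans _ _ 0%:E); last exact: ltry.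
apply/supnorm_leP; apply: aeW => x.
by rewrite /enorm /= expr0n addr0 sqrtr0.
Qed.

Let supnorm0 : supnorm (fun=> 0 : R * R) = 0%:E.
Proof.
apply/eqP; rewrite eq_le supnorm_ge0 andbT.
apply/supnorm_leP; apply: aeW => x.
by rewrite /enorm /= expr0n addr0 sqrtr0.
Qed.

(** The normalisation of the parameter at work: ||f||^2/||f|| = ||f||. The term 1 of 1 + C
    originates here. *)
Let energy0 : energy nf^-1 f (fun=> 0) = nf%:E.
Proof.
rewrite (energyE nf^-1 sf sqint0 is_div0 supnorm0) add0r; congr EFin.
have -> : (fun x => f x - (fun=> 0) x) = f by apply/funext => x; rewrite subr0.
by rewrite -sqr_nf expr2 mulKf// gt_eqF// nf_gt0.
Qed.

Let Linfty1 : Linfty_field u1 := u1_min.1.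

(** Otherwise the energy of [u1] would be [+oo], above the finite energy of the zero field. *)
Let divs1 : L2_divs u1 !=set0.
Proof.
apply: contrapT => n; have := u1_min.2 _ Linfty0.
by rewrite energy0 /energy; case: asboolP => // _; rewrite leye_eq.
Qed.

Let d1 := divL2 u1.

Lemma minimizer_div : sqint d1 /\ is_div u1 d1.
Proof. by have [h Hh] := divs1; have [/LfunP] := xgetPex (cst 0) divs1. Qed.

Let s : R := fine (supnorm u1).

Lemma supnorm_minimizer : supnorm u1 = s%:E.
Proof. by have [t t0 u1t] := supnorm_fin Linfty1; rewrite /s u1t. Qed.

Let r1 : R * R -> R := f \- d1.

Lemma residual_sqint : sqint r1.
Proof. exact: sqintB sf minimizer_div.1. Qed.

Lemma minimizer_le v h (S : R) : Linfty_field v -> sqint h -> is_div v h ->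
  (supnorm v <= S%:E)%E -> s + nf^-1 * sqnorm r1 <= S + nf^-1 * sqnorm (fun x => f x - h x).
Proof.
move=> Lv sh vh vS; have [t t0 vt] := supnorm_fin Lv.
have [sd1 ud1] := minimizer_div.
have := u1_min.2 _ Lv; rewrite (energyE _ sf sd1 ud1 supnorm_minimizer).
rewrite (energyE _ sf sh vh vt) lee_fin => /le_trans; apply.
by rewrite lerD2r -lee_fin -vt.
Qed.

Lemma supnorm_minimizer_le : s <= nf.
Proof.
have := minimizer_le Linfty0 sqint0 is_div0 (S := 0); rewrite supnorm0 lexx => /(_ isT).
have -> : (fun x => f x - (fun=> 0) x) = f by apply/funext => x; rewrite subr0.
rewrite -sqr_nf expr2 mulKf ?gt_eqF ?nf_gt0// add0r; apply: le_trans.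
by rewrite lerDl mulr_ge0 ?sqnorm_ge0// invr_ge0 ltW// nf_gt0.
Qed.

Lemma residual_pairing_le (w : R * R -> R * R) :
  test_function (fst \o w) -> test_function (snd \o w) -> (supnorm w <= 1)%E ->
  \int[leb2 R]_x (r1 x * classical_div w x) <= nf / 2.
Proof.
move=> /test_function_C1c C1 /test_function_C1c C2 w1.
have mw : measurable_fun setT (w : plane R -> plane R).
  by apply/measurable_fun_pairP; split; exact: C1c_measurable.
have Lw : Linfty_field w by split => //; apply: le_lt_trans w1 _; exact: ltry.
have sw : sqint (classical_div w).
  have := sqintD 1 (C1c_partial_sqint false C1) (C1c_partial_sqint true C2).
  by congr sqint; apply/funext => x; rewrite mul1r.
have dw := is_div_classical C1 C2.
have [sd1 ud1] := minimizer_div; have sr := residual_sqint.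
set I := \int[_]_x _.
(* Minimality against u1 + e w gives 0 <= e + (-2 e I + e^2 Q)/nf, where Q is the squared norm of
   div w; multiplying by nf/e yields the claim, and e is then sent to 0. *)
have key e : 0 < e -> 2 * I <= nf + e * sqnorm (classical_div w).
  move=> e0; have := minimizer_le (v := fun x => 1 *: u1 x + e *: w x)
    (h := fun x => 1 * d1 x + e * classical_div w x) (S := 1 * s + e * 1).
  have -> : (fun x => f x - (1 * d1 x + e * classical_div w x)) =
      (fun x => r1 x + - e * classical_div w x).
    by apply/funext => x; rewrite /r1 /=; ring.
  rewrite (sqnormD (- e) sr sw) -/I => h.
  have {h} : s + nf^-1 * sqnorm r1 <= 1 * s + e * 1 +
      nf^-1 * (sqnorm r1 + 2 * - e * I + (- e) ^+ 2 * sqnorm (classical_div w)).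
    apply: h.
    - by apply: Linfty_combine => //; exact: ltW.
    - by have := sqintD e sd1 sw; congr sqint; apply/funext => x; rewrite mul1r.
    - by apply: is_div_combine.
    - apply: supnorm_combine => //; first exact: ltW.
      by rewrite supnorm_minimizer.
  have n0 := nf_gt0; have ni : nf^-1 * nf = 1 by rewrite mulVf// gt_eqF.
  move=> h; rewrite -(ler_pM2l e0) -(ler_pM2l (_ : 0 < nf^-1)) ?invr_gt0//.
  rewrite mulrDr mulrDr [nf^-1 * (e * nf)]mulrCA ni.
  move: h; move: (nf^-1) (sqnorm _) (sqnorm _) => li q q'; nra.
rewrite -(ler_pM2l (_ : 0 < 2 :> R))// mulrCA divff// mulr1.
apply/ler_addgt0Pr => e e0.
(* Adding 1 keeps the denominator positive when div w = 0. *)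
have Q1 : 0 < sqnorm (classical_div w) + 1 by rewrite ltr_wpDl// sqnorm_ge0.
apply: le_trans (key (e / (sqnorm (classical_div w) + 1)) _) _; first by rewrite divr_gt0.
by rewrite lerD2l mulrAC ler_pdivrMr// ler_pM2l// lerDl.
Qed.

Lemma totvar_residual_le : (totvar r1 <= (nf / 2)%:E)%E.
Proof.
apply: ge_ereal_sup => _ [w [t1 t2 w1] <-].
by rewrite lee_fin; exact: residual_pairing_le.
Qed.

(** If [r1] vanished, f would be div u1 and (1 - e) u1 would have residual e f, whose energy term is
    e^2 ||f||. Minimality then gives s <= e ||f|| for all small e, so s = 0; hence u1 = 0 and f = 0
    almost everywhere, which is excluded. *)
Lemma residual_neq0 : ~ {ae leb2 R, forall x, r1 x = 0}.
Proof.
move=> r0; have [sd1 ud1] := minimizer_div; have sr := residual_sqint.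
have n0 := nf_gt0.
have Qr0 : sqnorm r1 = 0.
  by rewrite (sqnorm_ae sr sqint0 r0) /sqnorm; under eq_Rintegral do rewrite expr0n; rewrite Rintegral_cst// mul0r.
have df : {ae leb2 R, forall x, f x = d1 x}.
  by move: r0; apply: ae_imp => x /eqP; rewrite subr_eq0 => /eqP.
have key e : 0 < e < 1 -> s <= e * nf.
  (* The terms with coefficient 0 only cast (1 - e) u1 in the two-term form of the combination
     lemmas. *)
  move=> /andP[e0 e1]; have := minimizer_le (v := fun x => (1 - e) *: u1 x + 0 *: u1 x)
    (h := fun x => (1 - e) * d1 x + 0 * d1 x) (S := (1 - e) * s + 0 * s).
  have -> : sqnorm (fun x => f x - ((1 - e) * d1 x + 0 * d1 x)) = e ^+ 2 * nf ^+ 2.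
    have -> : (fun x => f x - ((1 - e) * d1 x + 0 * d1 x)) = (fun x => r1 x + e * d1 x).
      by apply/funext => x; rewrite /r1 /=; ring.
    rewrite (sqnormD e sr sd1) Qr0 sqr_nf (sqnorm_ae sf sd1 df).
    have -> : \int[leb2 R]_x (r1 x * d1 x) = 0.
      transitivity (\int[leb2 R]_x (0 : R)); last by rewrite Rintegral_cst// mul0r.
      congr fine; apply: ae_eq_integral => //.
        by have := sqint_mul_integrable sr sd1; exact: measurable_int.
      by move: r0; apply: ae_imp => x -> _; rewrite mul0r.
    by rewrite mulr0 addr0 add0r.
  rewrite Qr0 mulr0 addr0 => h.
  have {h} : s <= (1 - e) * s + 0 * s + nf^-1 * (e ^+ 2 * nf ^+ 2).
    apply: h.
    - by apply: Linfty_combine => //; lra.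
    - have := sqintD (- e) sd1 sd1; congr sqint; apply/funext => x; ring.
    - by apply: is_div_combine.
    - by apply: supnorm_combine => //; [lra|rewrite supnorm_minimizer..].
  have -> : nf^-1 * (e ^+ 2 * nf ^+ 2) = e * (e * nf) by field; rewrite gt_eqF.
  by move=> h; rewrite -(ler_pM2l e0); lra.
have s0 : s <= 0.
  (* The minimum with 1/2 keeps the parameter below 1, so that the competitor has a nonnegative
     coefficient. *)
  apply/ler_addgt0Pr => e e0; rewrite add0r; pose e' := Num.min (e / nf) (1 / 2).
  have e'0 : 0 < e' < 1 by rewrite lt_min divr_gt0//= gt_min; apply/andP; split => //; lra.
  apply: le_trans (key _ e'0) _; rewrite -ler_pdivlMr//.
  by rewrite ge_min lexx.
have u10 : {ae leb2 R, forall x, enorm (u1 x) <= 0}.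
  by apply/supnorm_leP; rewrite supnorm_minimizer lee_fin.
apply: f_neq0.
have ud0 : is_div u1 (fun=> 0 : R).
  move=> phi tphi; rewrite -[RHS](is_div0 tphi).
  have Cp := test_function_C1c tphi.
  congr fine; apply: ae_eq_integral => //.
  - exact: measurable_int (pairing_integrable Linfty1 Cp).
  - exact: measurable_int (pairing_integrable Linfty0 Cp).
  move: u10; apply: ae_imp => x ux _.
  have := le_trans (ler_enorm1 (u1 x)) ux; rewrite normr_le0 => /eqP ->.
  by have := le_trans (ler_enorm2 (u1 x)) ux; rewrite normr_le0 => /eqP ->.
have := is_div_unique sd1 sqint0 ud1 ud0.
by move: df; apply: ae_imp2 => x ->.
Qed.

End minimizer.

(** * The potential of a square integrable function *)

Section convolution_field.
Context {R : realType}.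
Variables (r : plane R -> R) (B : R).
Hypothesis sr : sqint r.
Hypothesis rB : forall x : plane R,
  (\int[leb2 R]_y (enorm (psi (x - y)%R) * `|r y|)%:E <= B%:E)%E.

Let mr : measurable_fun setT r := sr.1.

Let mpsi (x : plane R) : measurable_fun setT (fun y : plane R => (psi (x - y) : plane R)).
Proof. exact: (measurableT_comp (@measurable_psi R) (measurable_subl x)). Qed.

Let mpsi1 (x : plane R) : measurable_fun setT (fun y : plane R => (psi (x - y)).1 : R).
Proof. by have /measurable_fun_pairP[] := mpsi x. Qed.

Let mpsi2 (x : plane R) : measurable_fun setT (fun y : plane R => (psi (x - y)).2 : R).
Proof. by have /measurable_fun_pairP[] := mpsi x. Qed.

Lemma convolution_integrable (x : plane R) :
  (leb2 R).-integrable setT (fun y => (enorm (psi (x - y)) * r y)%:E).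
Proof.
apply/integrableP; split.
  apply/measurable_EFinP; apply: measurable_funM => //.
  exact: (measurableT_comp (@measurable_enorm R) (mpsi x)).
apply: le_lt_trans (ltry B); apply: le_trans (rB x).
rewrite le_eqVlt; apply/orP; left; apply/eqP; apply: eq_integral => y _ /=.
by rewrite normrM ger0_norm// enorm_ge0.
Qed.

Let convolution_integrable1 (x : plane R) :
  (leb2 R).-integrable setT (fun y => ((psi (x - y)).1 * r y)%:E).
Proof.
apply: le_integrable (convolution_integrable x) => //.
  by apply/measurable_EFinP; exact: measurable_funM.
move=> y _; rewrite lee_fin normrM [leRHS]normrM ler_wpM2r//.
exact: le_trans (ler_enorm1 (psi (x - y))) (ler_norm _).
Qed.

Let convolution_integrable2 (x : plane R) :
  (leb2 R).-integrable setT (fun y => ((psi (x - y)).2 * r y)%:E).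
Proof.
apply: le_integrable (convolution_integrable x) => //.
  by apply/measurable_EFinP; exact: measurable_funM.
move=> y _; rewrite lee_fin normrM [leRHS]normrM ler_wpM2r//.
exact: le_trans (ler_enorm2 (psi (x - y))) (ler_norm _).
Qed.

Let convolution1E (x : plane R) :
  (((convolution psi r x).1)%:E = \int[leb2 R]_y ((psi (x - y)%R).1 * r y)%:E)%E.
Proof. by rewrite fineK//; apply: integrable_fin_num => //; exact: convolution_integrable1. Qed.

Let convolution2E (x : plane R) :
  (((convolution psi r x).2)%:E = \int[leb2 R]_y ((psi (x - y)%R).2 * r y)%:E)%E.
Proof. by rewrite fineK//; apply: integrable_fin_num => //; exact: convolution_integrable2. Qed.

(** With a the value of the convolution, |a|^2 is the integral of (a . psi) r, which Cauchy-Schwarz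
    bounds by |a| B. Dividing by |a| avoids the loss of an estimate by components. *)
Lemma enorm_convolution_le (x : plane R) : enorm (convolution psi r x) <= B.
Proof.
set a := convolution psi r x.
have [a0|a0] := eqVneq (enorm a) 0.
  rewrite a0 -lee_fin; apply: le_trans (rB x); apply: integral_ge0 => y _.
  by rewrite lee_fin mulr_ge0 ?enorm_ge0.
have a_gt0 : 0 < enorm a by rewrite lt_def a0 enorm_ge0.
rewrite -(ler_pM2l a_gt0) -expr2 sqr_enorm !expr2 -lee_fin.
have i1 := integrableZl measurableT a.1 (convolution_integrable1 x).
have i2 := integrableZl measurableT a.2 (convolution_integrable2 x).
have i12 := integrableD measurableT i1 i2.
have -> : (a.1 * a.1 + a.2 * a.2)%:E =
    (\int[leb2 R]_y (a.1%:E * ((psi (x - y)).1 * r y)%:E + a.2%:E * ((psi (x - y)).2 * r y)%:E))%E.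
  rewrite integralD// !integralZl// EFinD !EFinM.
  by rewrite -convolution1E -convolution2E.
rewrite EFinM; apply: (@le_trans _ _ ((enorm a)%:E *
  \int[leb2 R]_y (enorm (psi (x - y)) * `|r y|)%:E)%E); last first.
  by rewrite lee_wpmul2l ?lee_fin ?enorm_ge0.
have ig : (leb2 R).-integrable setT (fun y => (enorm (psi (x - y)) * `|r y|)%:E).
  have := integrable_abse (convolution_integrable x); congr (integrable _ _ _).
  by apply/funext => y /=; rewrite normrM ger0_norm// enorm_ge0.
rewrite -integralZl//; apply: le_integral => //; first exact: integrableZl.
move=> y _; rewrite -!EFinM -EFinD lee_fin.
clearbody a; move: (psi (x - y)) (r y) => p t; rewrite !mulrA -mulrDl.
apply: le_trans (ler_norm _) _; rewrite normrM ler_wpM2r//.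
exact: enorm_dot.
Qed.

Let measurable_partial_integral (w : plane R -> R) : measurable_fun setT w ->
  measurable_fun setT (fun x : plane R => \int[leb2 R]_y (w (x - y) * r y)).
Proof.
move=> mw; pose G (z : plane R * plane R) := (w (z.1 - z.2) * r z.2)%:E.
have mG : measurable_fun setT G.
  apply/measurable_EFinP; apply: measurable_funM.
    exact: (measurableT_comp mw (@measurable_sub_plane R)).
  by apply: (measurableT_comp mr); exact: measurable_snd.
apply: (measurableT_comp (fine_measurable measurableT)).
(* Tonelli measurability concerns nonnegative integrands, hence the split into positive and negative
   parts. *)
have -> : (fun x : plane R => \int[leb2 R]_y (w (x - y) * r y)%:E)%E =
    (fun x => \int[leb2 R]_y G^\+ (x, y) - \int[leb2 R]_y G^\- (x, y))%E.
  apply/funext => x; rewrite integralE; congr (_ - _)%E;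
  by apply: eq_integral => y _; rewrite ?funeposE ?funenegE.
apply: emeasurable_funB; apply: measurable_integral_plane => //.
- exact: measurable_funepos.
- exact: measurable_funeneg.
Qed.

Lemma measurable_convolution : measurable_fun setT (convolution psi r : plane R -> plane R).
Proof.
have /measurable_fun_pairP[m1 m2] := @measurable_psi R.
apply: measurable_fun_pair.
  exact: (measurable_partial_integral (w := fun z => (psi z).1) m1).
exact: (measurable_partial_integral (w := fun z => (psi z).2) m2).
Qed.

(** After testing against [phi] and exchanging the integrals, the substitution z = x - y turns the
    integral over x into the pairing of [psi] with the gradient of the translate phi(y + .), which
    is -phi(y). *)
Lemma is_div_convolution : is_div (convolution psi r) r.
Proof.
move=> phi tphi; have Cp := test_function_C1c tphi.
pose d (z : plane R * plane R) := (psi (z.1 - z.2)).1 * partial false phi z.1 +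
  (psi (z.1 - z.2)).2 * partial true phi z.1.
pose G (z : plane R * plane R) := (d z * r z.2)%:E.
have msub := measurableT_comp (@measurable_psi R) (@measurable_sub_plane R).
have md : measurable_fun setT d.
  have /measurable_fun_pairP[m1 m2] := msub.
  apply: measurable_funD; apply: measurable_funM => //.
    by apply: (measurableT_comp (C1c_partial_measurable false Cp)); exact: measurable_fst.
  by apply: (measurableT_comp (C1c_partial_measurable true Cp)); exact: measurable_fst.
have mG : measurable_fun setT G.
  apply/measurable_EFinP; apply: measurable_funM => //.
  by apply: (measurableT_comp mr); exact: measurable_snd.
pose D x := `|partial false phi x| + `|partial true phi x|.
have D0 x : 0 <= D x by rewrite addr_ge0.
have iD : (leb2 R).-integrable setT (EFin \o D).
  exact: integrableD (integrable_abse (C1c_partial_integrable false Cp))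
    (integrable_abse (C1c_partial_integrable true Cp)).
(* The uniform bound [B] on the inner integral leaves [B * D x], integrable in [x]: this is the
   absolute convergence that Fubini requires. *)
have Gfin : (\int[leb2 R]_x \int[leb2 R]_y `|G (x, y)| < +oo)%E.
  have iBD := integrableZl measurableT B iD.
  apply: le_lt_trans (integrable_lty measurableT iBD); apply: ge0_le_integral => //.
  - by move=> x _; exact: integral_ge0.
  - apply: (measurable_integral_plane (G := fun z => `|G z|%E)) => //; exact: measurableT_comp.
  - by apply: emeasurable_funM => //; exact: measurable_int iD.
  move=> x _; apply: (@le_trans _ _ (\int[leb2 R]_y ((D x)%:E * (enorm (psi (x - y)%R) * `|r y|)%:E))%E).
    apply: ge0_le_integral => //.
    - apply: measurableT_comp => //; apply: (measurableT_comp mG); exact: pair1_measurable.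
    - apply: emeasurable_funM => //; apply/measurable_EFinP; apply: measurable_funM.
        exact: (measurableT_comp (@measurable_enorm R) (mpsi x)).
      exact: measurableT_comp.
    - move=> y _.
      have -> : `|G (x, y)|%E = (`|((psi (x - y)).1 * partial false phi x +
        (psi (x - y)).2 * partial true phi x) * r y|)%:E by [].
      rewrite -EFinM lee_fin /D.
      move: (psi (x - y)) (r y) (partial false phi x) (partial true phi x) => p t b b'.
      rewrite normrM mulrA ler_wpM2r// [leRHS]mulrC mulrDr.
      apply: le_trans (ler_normD _ _) _; rewrite !normrM.
      by rewrite lerD// ler_wpM2r// ?ler_enorm1 ?ler_enorm2.
  rewrite ge0_integralZl ?lee_fin//.
  - by rewrite muleC lee_wpmul2r ?lee_fin.
  - apply/measurable_EFinP; apply: measurable_funM.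
      exact: (measurableT_comp (@measurable_enorm R) (mpsi x)).
    exact: measurableT_comp.
  - by move=> y _; rewrite lee_fin mulr_ge0 ?enorm_ge0.
have inner1 x : (\int[leb2 R]_y G (x, y) =
    ((convolution psi r x).1 * partial false phi x + (convolution psi r x).2 * partial true phi x)%:E)%E.
  have i1 := integrableZl measurableT (partial false phi x) (convolution_integrable1 x).
  have i2 := integrableZl measurableT (partial true phi x) (convolution_integrable2 x).
  transitivity (\int[leb2 R]_y ((partial false phi x)%:E * ((psi (x - y)%R).1 * r y)%:E +
      (partial true phi x)%:E * ((psi (x - y)%R).2 * r y)%:E))%E.
    apply: eq_integral => y _; rewrite -!EFinM -EFinD; congr EFin; rewrite /d -[(x, y).1]/x -[(x, y).2]/y.
    by move: (psi (x - y)) (r y) (partial _ _ _) (partial _ _ _) => p t b b'; ring.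
  rewrite integralD// !integralZl// EFinD !EFinM [in LHS]muleC [X in (_ + X)%E]muleC.
  by rewrite -convolution1E -convolution2E.
have inner2 y : (\int[leb2 R]_x G (x, y) = (- (r y * phi y))%:E)%E.
  have Cs := C1c_shift y Cp.
  transitivity (\int[leb2 R]_z ((r y)%:E * (psi_grad (fun z => phi (y + z)) z)%:E))%E.
    rewrite -(@integral_subr R y (fun z => (r y)%:E * (psi_grad (fun z => phi (y + z)) z)%:E)%E).
      apply: eq_integral => x _; rewrite -EFinM /G /d /psi_grad !partial_shift -[(x, y).1]/x -[(x, y).2]/y.
      by congr EFin; rewrite [y + _]addrC subrK mulrC.
    by apply: emeasurable_funM => //; apply/measurable_EFinP; exact: measurable_psi_grad.
  rewrite integralZl//; last exact: psi_grad_integrable.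
  by rewrite integral_psi_grad// -EFinM -[(0, 0)]/(0 : R * R) addr0 mulrN.
transitivity (fine (\int[leb2 R]_x \int[leb2 R]_y G (x, y))%E).
  by congr fine; apply: eq_integral => x _; rewrite inner1.
rewrite (fubini_plane mG Gfin).
have irp := sqint_mul_integrable sr (C1c_sqint Cp).
have -> : (\int[leb2 R]_y \int[leb2 R]_x G (x, y) = - \int[leb2 R]_y (r y * phi y)%:E)%E.
  transitivity (\int[leb2 R]_y ((-1)%:E * (r y * phi y)%:E))%E.
    by apply: eq_integral => y _; rewrite inner2 -EFinM mulN1r.
  by rewrite (integralZl measurableT irp) EFinN mulN1e.
by rewrite fineN.
Qed.

End convolution_field.

(** * Positivity of the Lorentz norm and the final estimate *)

Section conclusion.
Context {R : realType}.

Lemma test_function0 : test_function (fun=> 0 : R).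
Proof.
split.
  apply: (smooth_coind (S := [set fun=> 0])) => //.
  - by move=> _ ->; exact: cst_continuous.
  - by move=> _ i x ->; exact: derivable_cst.
  - by move=> _ i ->; apply/funext => x; exact: derive_cst.
rewrite (_ : [set x : R * R | _] = set0) ?closure0; first exact: compact0.
by apply/seteqP; split => x //=; rewrite eqxx.
Qed.

Lemma totvar_ge0 (g : R * R -> R) : (0 <= totvar g)%E.
Proof.
apply: ereal_sup_ubound; exists (fun=> 0 : R * R).
  split; [exact: test_function0|exact: test_function0|].
  apply/supnorm_leP; apply: aeW => x.
  by rewrite /enorm /= expr0n addr0 sqrtr0.
congr EFin; transitivity (\int[leb2 R]_x (0 : R)); last by rewrite Rintegral_cst// mul0r.
apply: eq_Rintegral => x _.
by rewrite /classical_div /partial !derive_cst addr0 mulr0.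
Qed.

Lemma lorentz21_ge0 (g : R * R -> R) : (0 <= lorentz21 g)%E.
Proof. by rewrite mule_ge0// integral_ge0// => t _; exact: poweR_ge0. Qed.

Lemma convolution_psi_le (K l : R) (r : R * R -> R) : weak_bound psi K -> sqint r ->
  lorentz21 r = l%:E -> forall x : plane R,
  (\int[leb2 R]_y (enorm (psi (x - y)%R) * `|r y|)%:E <= (K / 2 * l)%R%:E)%E.
Proof.
move=> wK sr rl x; rewrite EFinM -rl; apply: convolution_bound => //.
  exact: sr.1.
by move=> t; exact: sqint_level.
Qed.

(* If the Lorentz norm vanished, so would the potential of [r], and hence its divergence [r]. *)
Lemma lorentz21_gt0 (r : R * R -> R) : sqint r -> ~ {ae leb2 R, forall x, r x = 0} ->
  (0 < lorentz21 r)%E.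
Proof.
move=> sr r_neq0; rewrite lt_def lorentz21_ge0 andbT; apply: contra_notN r_neq0 => /eqP l0.
have [K wK] := @psi_weakL2 R.
have rB := convolution_psi_le wK sr l0; rewrite mulr0 in rB.
have := is_div_convolution sr rB.
have -> : convolution psi r = fun=> 0.
  apply/funext => x; apply/eqP; apply: contraT => /enorm_gt0.
  by rewrite ltNge enorm_convolution_le.
by move=> dr; exact: is_div_unique sr sqint0 dr is_div0.
Qed.

Lemma weakL2norm_psi_fin : exists2 w : R, 0 <= w & weakL2norm psi = w%:E :> \bar R.
Proof.
have [K wK] := @psi_weakL2 R.
have W0 : (0 <= weakL2norm psi :> \bar R)%E.
  by apply: le_ereal_inf_tmp => _ [K' wK' <-]; rewrite lee_fin; exact: weak_bound_ge0 wK'.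
have WK : (weakL2norm psi <= K%:E)%E by apply: ereal_inf_lbound; exists K.
exists (fine (weakL2norm psi)); first exact: fine_ge0.
by rewrite fineK// ge0_fin_numE// (le_lt_trans WK)// ltry.
Qed.

End conclusion.

Theorem mainTheorem6 (R : realType) (Omega : set (R * R)) (f0 : R * R -> R)
    (beta2 : R) (u1 : R * R -> R * R) :
  Omega !=set0 -> open Omega -> connected Omega ->
  let f : R * R -> R := f0 \_ Omega in
  f \in Lfun (leb2 R) 2%:E ->
  ~ {ae leb2 R, forall x, f x = 0} ->
  TV_lorentz_bound beta2 ->
  let lambda : R := (fine (L2norm f))^-1 in
  energy_minimizer lambda f u1 ->
  let r1 : R * R -> R := f \- divL2 u1 in
  let u2 : R * R -> R * R := convolution psi r1 in
  let u : R * R -> R * R := u1 \+ u2 in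
  let C : \bar R := ((beta2 / 2)%:E * weakL2norm psi)%E in
  [/\ {ae leb2 R, forall x,
        (leb2 R).-integrable setT (fun y => (enorm (psi (x - y)) * r1 y)%:E)},
      Linfty_field u,
      is_div u f
    & (supnorm u <= (1 + C) * L2norm f)%E].
Proof.
move=> _ _ _ f /LfunP sf f_neq0 TVb lambda u1_min r1 u2 u C.
have nf_gt0 := nf_gt0 sf f_neq0; have nfE := L2norm_fineK sf.
have u1s := supnorm_minimizer u1_min.
have s_le := supnorm_minimizer_le sf f_neq0 u1_min.
have [sd1 ud1] := minimizer_div sf f_neq0 u1_min.
have sr : sqint r1 := residual_sqint sf f_neq0 u1_min.
have tv_le := totvar_residual_le sf f_neq0 u1_min; rewrite -/r1 in tv_le.
have r1_neq0 := residual_neq0 sf f_neq0 u1_min; rewrite -/r1 in r1_neq0.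
set nf := fine (L2norm f) in nf_gt0 nfE s_le tv_le *.
set s := fine (supnorm u1) in u1s s_le.
have L_gt0 := lorentz21_gt0 sr r1_neq0.
have L_le : (lorentz21 r1 <= beta2%:E * totvar r1)%E.
  by apply: TVb; [exact/LfunP|apply: le_lt_trans tv_le _; exact: ltry].
have [t t0 tvE] : exists2 t : R, 0 <= t & totvar r1 = t%:E.
  exists (fine (totvar r1)); first by rewrite fine_ge0// totvar_ge0.
  by rewrite fineK// ge0_fin_numE ?totvar_ge0// (le_lt_trans tv_le)// ltry.
have [l lE] : exists l : R, lorentz21 r1 = l%:E.
  exists (fine (lorentz21 r1)); rewrite fineK// ge0_fin_numE ?lorentz21_ge0//.
  by apply: le_lt_trans L_le _; rewrite tvE -EFinM ltry.
have l_gt0 : 0 < l by rewrite -lte_fin -lE.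
have l_le : l <= beta2 * t by rewrite -lee_fin -lE EFinM -tvE.
have t_le : t <= nf / 2 by rewrite -lee_fin -tvE.
(* A nonpositive [beta2] would contradict 0 < l <= beta2 t, since t >= 0. *)
have beta_gt0 : 0 < beta2.
  by rewrite ltNge; apply/negP => b0; move: (lt_le_trans l_gt0 l_le); rewrite ltNge mulr_le0_ge0.
have [w w0 wE] := @weakL2norm_psi_fin R.
(* Dividing by l > 0 turns the estimate with an arbitrary weak constant [K] into a lower bound for
   all such constants, so the infimum enters without being shown to be attained. *)
have u2_le x : enorm (u2 x) <= w / 2 * l.
  have h : (((2 * enorm (u2 x) / l)%:E : \bar R) <= weakL2norm psi)%E.
    apply: le_ereal_inf_tmp => _ [K wK <-].
    have := enorm_convolution_le sr (convolution_psi_le wK sr lE) x.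
    by rewrite lee_fin ler_pdivrMr//; lra.
  by move: h; rewrite wE lee_fin ler_pdivrMr//; lra.
(* Any finite weak constant serves here: [rB] provides absolute convergence and the divergence of
   [u2], while the exact constant is already in [u2_le]. *)
have [K wK] := @psi_weakL2 R.
have rB := convolution_psi_le wK sr lE.
have u2b : (supnorm u2 <= (w / 2 * l)%:E)%E by apply/supnorm_leP; exact: aeW.
have Lu2 : Linfty_field u2.
  split; first exact: (measurable_convolution sr).
  by apply: le_lt_trans u2b _; exact: ltry.
have uE : u = fun x => 1 *: u1 x + 1 *: u2 x.
  by apply/funext => x; rewrite !scale1r.
have Lu1 : Linfty_field u1 := u1_min.1.
split.
- by apply: aeW => x; exact: (convolution_integrable sr rB x).
- by rewrite uE; exact: Linfty_combine.
- rewrite uE (_ : f = fun x => 1 * divL2 u1 x + 1 * r1 x); last first.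
    by apply/funext => x; rewrite /r1 /= !mul1r subrKC.
  by apply: is_div_combine => //; exact: (is_div_convolution sr rB).
- rewrite uE; apply: le_trans (supnorm_combine ler01 ler01 (S := s) (T := w / 2 * l) _ u2b) _.
    by rewrite u1s.
  rewrite /C wE nfE.
  have -> : ((1 + (beta2 / 2)%:E * w%:E) * nf%:E = ((1 + beta2 / 2 * w) * nf)%:E)%E by [].
  rewrite lee_fin !mul1r.
  (* The bound on the total variation is multiplied by [beta2], which is where its positivity
     enters. *)
  have h1 : l <= beta2 * (nf / 2) by apply: le_trans l_le _; rewrite ler_pM2l.
  have h2 : w / 2 * l <= w / 2 * (beta2 * (nf / 2)) by rewrite ler_wpM2l// divr_ge0.
  (* The estimate of [u2] carries 1/4 where C ||f|| carries 1/2; this nonnegativity absorbs the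
     difference. *)
  have h3 : 0 <= w * beta2 * nf by rewrite !mulr_ge0// ltW.
  have h4 : (1 + beta2 / 2 * w) * nf = nf + (w * beta2 * nf) / 2 by field.
  have h5 : w / 2 * (beta2 * (nf / 2)) = (w * beta2 * nf) / 4 by field.
  rewrite h4; rewrite h5 in h2; lra.
Qed.
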